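(* Let $\Phi:\mathbb{R}^2\to[0,\infty[$ be measurable. (a) (Non-relativistic case.) Let $U\in C^1(]0,\infty[)$ satisfy $$U'(r)=\frac{4\pi}{r^2}\int_0^r s^2\rho(s)\,ds,\qquad r>0,$$ where $$\rho(r)=\rho(x)=\int_{\mathbb{R}^3} f(x,v)\,dv,\qquad f(x,v)=\Phi\big(E(x,v),L(x,v)\big),$$ with $E(x,v)=\tfrac12|v|^2+U(|x|)$, $L(x,v)=|x\times v|^2$ and $r=|x|$. Assume that the mass $M=\int_{\mathbb{R}^3}\rho(x)\,dx$ is finite. Then $U_\infty=\lim_{r\to\infty}U(r)$ exists and is finite, and $\Phi(E,L)=0$ for almost every $(E,L)$ with $E>U_\infty$ and $L>0$. (b) (Relativistic case.) Let $\lambda,\mu\in C^1(]0,\infty[)$ satisfy, for $r>0$, $$e^{-2\lambda}(2r\lambda'-1)+1=8\pi r^2\rho,\qquad e^{-2\lambda}(2r\mu'+1)-1=8\pi r^2 p,$$ where $$\rho(r)=\int_{\mathbb{R}^3}\sqrt{1+|v|^2}\,f(x,v)\,dv,\qquad p(r)=\int_{\mathbb{R}^3}\Big(\frac{x\cdot v}{r}\Big)^2 f(x,v)\,\frac{dv}{\sqrt{1+|v|^2}},$$ with $f(x,v)=\Phi(E(x,v),L(x,v))$, $E(x,v)=e^{\mu(|x|)}\sqrt{1+|v|^2}$, $L(x,v)=|x\times v|^2$ and $r=|x|$. Assume moreover the regular-center condition, in the form $e^{-2\lambda(r)}=1-2m(r)/r$ for all $r>0$, where $m(r)=4\pi\int_0^r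 s^2\rho(s)\,ds$. Assume that the ADM mass $M=\int_{\mathbb{R}^3}\rho(x)\,dx$ is finite. Then $\mu_\infty=\lim_{r\to\infty}\mu(r)$ exists and is finite, and $\Phi(E,L)=0$ for almost every $(E,L)$ with $E>e^{\mu_\infty}$ and $L>0$.
   Context: Here $x,v\in\mathbb{R}^3$, $\cdot$ is the Euclidean inner product and $\times$ the cross product. The functions $\rho$ and $p$ depend only on $r=|x|$ because of spherical symmetry. *)

(* Defs.v *)
From HB Require Import structures.
From mathcomp Require Import all_boot all_order all_algebra.
From mathcomp Require Import all_classical all_reals all_analysis.
Set Implicit Arguments. Unset Strict Implicit. Unset Printing Implicit Defensive.
Import Order.TTheory GRing.Theory Num.Theory.
Import numFieldNormedType.Exports.
Local Open Scope classical_set_scope.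
Local Open Scope ring_scope.

Definition vec3 (R : realType) := ((R * R) * R)%type.

Section Defs.
Variable R : realType.

Definition c1 (x : vec3 R) : R := x.1.1.
Definition c2 (x : vec3 R) : R := x.1.2.
Definition c3 (x : vec3 R) : R := x.2.

Definition dot3 (x v : vec3 R) : R := c1 x * c1 v + c2 x * c2 v + c3 x * c3 v.
Definition norm3 (x : vec3 R) : R := Num.sqrt (dot3 x x).
Definition cross3 (x v : vec3 R) : vec3 R :=
  ((c2 x * c3 v - c3 x * c2 v, c3 x * c1 v - c1 x * c3 v),
    c1 x * c2 v - c2 x * c1 v).

(* the point (r, 0, 0), used to read the radial functions rho(r), p(r) *)
Definition radial_pt (r : R) : vec3 R := ((r, 0), 0).

Definition leb := @lebesgue_measure R.
Definition leb2 := (leb \x leb)%E.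
Definition leb3 := (leb2 \x leb)%E.

Definition Lmom (x v : vec3 R) : R := norm3 (cross3 x v) ^+ 2.

Definition E_nr (U : R -> R) (x v : vec3 R) : R := norm3 v ^+ 2 / 2 + U (norm3 x).
Definition rho_nr (Phi : R * R -> R) (U : R -> R) (x : vec3 R) : \bar R :=
  (\int[leb3]_v (Phi (E_nr U x v, Lmom x v))%:E)%E.

Definition E_r (mu : R -> R) (x v : vec3 R) : R :=
  expR (mu (norm3 x)) * Num.sqrt (1 + norm3 v ^+ 2).
Definition f_r (Phi : R * R -> R) (mu : R -> R) (x v : vec3 R) : R :=
  Phi (E_r mu x v, Lmom x v).
Definition rho_r (Phi : R * R -> R) (mu : R -> R) (x : vec3 R) : \bar R :=
  (\int[leb3]_v (Num.sqrt (1 + norm3 v ^+ 2) * f_r Phi mu x v)%:E)%E.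
Definition p_r (Phi : R * R -> R) (mu : R -> R) (x : vec3 R) : \bar R :=
  (\int[leb3]_v ((dot3 x v / norm3 x) ^+ 2 * f_r Phi mu x v
                   / Num.sqrt (1 + norm3 v ^+ 2))%:E)%E.
Definition mass_r (Phi : R * R -> R) (mu : R -> R) (r : R) : \bar R :=
  ((4 * pi)%:E * \int[@lebesgue_measure R]_(s in `[0%R, r]) ((s ^+ 2)%:E * rho_r Phi mu (radial_pt s)))%E.

End Defs.
Arguments leb2 : clear implicits.
Arguments leb3 : clear implicits.
Arguments leb : clear implicits.

(* Main.v *)
(** The potential is nondecreasing, and the mass inside radius [r] is at most a
    constant times [M]; this bounds the potential, which hence converges. (In
    the relativistic case [m' = 4 pi r^2 rho] is read off the first field
    equation, and [p <= rho] turns the second one into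
    [mu' <= 2 m / r^2 + 2 m' / r] as soon as [2 m / r <= 1 / 2].)

    Now fix a box [[E0, E1] x [L0, L1]] with [E0] above the limit energy and
    [L0 > 0]. For every large radius [s] the box is in the range of
    [v |-> (E, L)] at [x = (s, 0, 0)]. Substituting [E] for [v_1] and
    [L = s^2 (v_2^2 + v_3^2)] for [v_2], and integrating over
    [0 <= v_3 <= sqrt L0 / s], gives [s^2 rho(s) >= c * int_box Phi] where
    [c > 0] does not depend on [s]. As [int s^2 rho(s) ds <= 4 M] is finite,
    [int_box Phi = 0].

    Only inequalities are needed, so polar coordinates are replaced throughout
    by one-dimensional substitutions along monotone [C]-Lipschitz maps, which
    lose at most a factor [C]. *)

Require Import Defs.
From HB Require Import structures.
From mathcomp Require Import all_boot all_order all_algebra.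
From mathcomp Require Import all_classical all_reals all_analysis measurable_realfun.
From mathcomp Require Import ring lra.
Import Order.TTheory GRing.Theory Num.Theory.
Import numFieldNormedType.Exports.
Local Open Scope classical_set_scope.
Local Open Scope ring_scope.
Set Implicit Arguments.
Unset Strict Implicit.
Unset Printing Implicit Defensive.

(** * Lipschitz substitution *)

(** A simple function below [f] extended by zero off [A] is also below [g] extended by zero off [B],
    so the suprema defining the two integrals compare directly. This allows comparing integrands
    whose measurability has not been established. *)
Lemma ge0_le_integralW d (T : measurableType d) (R : realType)
    (mu : {measure set T -> \bar R}) (A B : set T) (f g : T -> \bar R) :
  A `<=` B -> (forall x, A x -> 0 <= f x)%E -> (forall x, B x -> 0 <= g x)%E ->
  (forall x, A x -> f x <= g x)%E ->
  (\int[mu]_(x in A) f x <= \int[mu]_(x in B) g x)%E.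
Proof.
move=> AB f0 g0 fg; rewrite !ge0_integralE//.
apply: ge_ereal_sup => _ [h/= hf <-]; apply: ereal_sup_ubound; exists h => //= x.
apply: (le_trans (hf x)); rewrite /patch; case: ifPn => xA.
  by rewrite ifT; [apply: fg|]; move: xA; rewrite !inE// => /AB.
by case: ifPn => //; rewrite inE; exact: g0.
Qed.

Section substitution.
Variable R : realType.
Notation mu := (@lebesgue_measure R).

Lemma ge0_integral_translation (a : R) (f : R -> \bar R) :
  measurable_fun [set: R] f -> (forall x, 0 <= f x)%E ->
  (\int[mu]_x f (x + a)%R = \int[mu]_x f x)%E.
Proof.
move=> mf f0.
have mT : measurable_fun setT ((fun x => x + a) : measurableTypeR R -> measurableTypeR R).
  by apply: measurable_funD => //; exact: measurable_cst.
transitivity (\int[pushforward mu ((fun x => x + a)%R : measurableTypeR R -> measurableTypeR R)]_x f x)%E; last first.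
  apply: eq_measure_integral => //= A mA _; apply/esym.
  apply: lebesgue_measure_unique => //= _ [[u v]] _ <-.
  rewrite /pushforward (_ : _ @^-1` _ = `](u - a), (v - a)]%classic).
    rewrite !lebesgue_measure_itv/= !lte_fin ltrD2r; case: ifPn => // _.
    by rewrite -!EFinB; congr EFin; ring.
  by apply/seteqP; split => x /=; rewrite !in_itv/= ltrBlDr lerBrDr.
by rewrite ge0_integral_pushforward.
Qed.

(** Take a cover of the preimage by intervals []u, v]]. Since [psi] is onto, the intervals
    [[psi u, psi v]] cover [S], and each has length at most [C * (v - u)]; the infimum over all
    covers gives the bound. *)
Lemma lebesgue_measure_le_preimage (psi : R -> R) (C : R) (S : set R) :
  0 < C -> (forall x y, x <= y -> psi x <= psi y <= psi x + C * (y - x)) ->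
  (forall y, exists x, psi x = y) -> measurable S ->
  (mu S <= C%:E * mu (psi @^-1` S))%E.
Proof.
move=> C0 psiP surj mS.
rewrite muleC -lee_pdivrMr//.
rewrite [leRHS]/lebesgue_measure /lebesgue_stieltjes_measure /measure_extension/= /mu_ext.
apply: le_ereal_inf_tmp => _ [F [mF AF] <-].
rewrite lee_pdivrMr//.
have /choice[uv uvE] : forall k, exists p : R * R, F k = `]p.1, p.2]%classic.
  by move=> k; have [p _ <-] := mF k; exists p.
(* The interval is closed on the left because [psi] may be constant to the right of [u] and take the
   value [psi u] inside []u, v]]. *)
pose G k : set R := if (uv k).1 < (uv k).2 then `[psi (uv k).1, psi (uv k).2]%classic else set0.
have mG k : measurable (G k) by rewrite /G; case: ifPn.
have SG : S `<=` \bigcup_k G k.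
  move=> y Sy; have [x xy] := surj y.
  have /AF [k _ Fkx] : (psi @^-1` S) x by rewrite /= xy.
  exists k => //; move: Fkx; rewrite uvE /= in_itv/= => /andP[ux xv].
  rewrite /G (lt_le_trans ux xv) /= in_itv/= -xy.
  by have /andP[-> _] := psiP _ _ (ltW ux); have /andP[-> _] := psiP _ _ xv.
apply: (le_trans (measure_sigma_subadditive mu mG mS SG)).
rewrite muleC -nneseriesZl; last by move=> *; exact: wlength_ge0.
apply: lee_nneseries => // k _.
rewrite /G uvE; case: ifPn => [uv0|_].
  rewrite [X in (X <= _)%E](lebesgue_measure_itv `[_, _])/= wlength_itv/= lte_fin !lte_fin uv0.
  have /andP[h1 h2] := psiP _ _ (ltW uv0).
  case: ifPn => _; rewrite -?EFinB -?EFinM lee_fin.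
    lra.
  by apply: mulr_ge0; [exact: ltW|rewrite subr_ge0 ltW].
by rewrite measure0 mule_ge0// ?lee_fin ?(ltW C0)// wlength_ge0.
Qed.

Lemma lipschitz_continuous (psi : R -> R) (C : R) :
  0 < C -> (forall x y, x <= y -> psi x <= psi y <= psi x + C * (y - x)) ->
  continuous psi.
Proof.
move=> C0 psiP x; apply/cvgrPdist_le => e e0; near=> y.
have : `|x - y| <= e / C.
  near: y; apply: cvgr_dist_le => //; exact: divr_gt0.
rewrite ler_pdivlMr// => h.
apply: (le_trans _ h); have [xy|/ltW yx] := leP x y.
  have /andP[h1 h2] := psiP _ _ xy.
  by rewrite distrC ger0_norm ?subr_ge0// distrC ger0_norm ?subr_ge0//; lra.
have /andP[h1 h2] := psiP _ _ yx.
by rewrite ger0_norm ?subr_ge0// ger0_norm ?subr_ge0//; lra.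
Unshelve. all: by end_near. Qed.

(** The previous measure bound says that [C] times the pushforward of Lebesgue measure by [psi]
    dominates Lebesgue measure; integrals of [h] then compare. *)
Lemma lipschitz_substitution_onto (psi : R -> R) (C : R) (h : R -> \bar R) :
  0 < C -> (forall x y, x <= y -> psi x <= psi y <= psi x + C * (y - x)) ->
  (forall y, exists x, psi x = y) -> measurable_fun [set: R] h ->
  (forall x, 0 <= h x)%E ->
  (\int[mu]_x h x <= C%:E * \int[mu]_x h (psi x))%E.
Proof.
move=> C0 psiP surj mh h0.
have mpsi : measurable_fun setT (psi : measurableTypeR R -> measurableTypeR R).
  by apply: continuous_measurable_fun; exact: lipschitz_continuous C0 psiP.
pose nu : {measure set (measurableTypeR R) -> \bar R} :=
  pushforward mu (psi : measurableTypeR R -> measurableTypeR R).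
have -> : (C%:E * \int[mu]_x h (psi x) = \int[mscale (NngNum (ltW C0)) (nu mpsi)]_x h x)%E.
  by rewrite ge0_integral_mscale// ge0_integral_pushforward.
apply: ge0_le_measure_integral => // S mS.
exact: lebesgue_measure_le_preimage.
Qed.

Lemma lipschitz_substitution (psi : R -> R) (a b c d C : R) (h : R -> \bar R) :
  0 < C -> a <= b ->
  (forall x y, a <= x -> x <= y -> y <= b ->
     psi x <= psi y <= psi x + C * (y - x)) ->
  psi a <= c -> d <= psi b -> measurable_fun [set: R] h ->
  (forall x, 0 <= h x)%E ->
  (\int[mu]_(x in `[c, d]) h x <= C%:E * \int[mu]_(x in `[a, b]) h (psi x))%E.
Proof.
move=> C0 ab psiP ac db mh h0.
(* [cl] clamps to [[a, b]]; [psi'] below extends [psi] outside [[a, b]] with slope [C], which keeps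
   the Lipschitz bound and makes it onto. *)
pose cl x := if x <= a then a else if b <= x then b else x.
have clP x : a <= cl x <= b.
  by rewrite /cl; case: (leP x a) => ?; [|case: (leP b x) => ?]; apply/andP; split; lra.
have clL x y : x <= y -> cl x <= cl y <= cl x + (y - x).
  move=> xy; rewrite /cl; case: (leP x a); case: (leP y a); case: (leP b x);
    case: (leP b y) => *; apply/andP; split; lra.
pose psi' x := psi (cl x) + C * (x - cl x).
have psi'P x y : x <= y -> psi' x <= psi' y <= psi' x + C * (y - x).
  move=> xy; have /andP[h1 h2] := clL _ _ xy.
  have /andP[ax _] := clP x; have /andP[_ yb] := clP y.
  have /andP[h3 h4] := psiP _ _ ax h1 yb.
  by rewrite /psi'; apply/andP; split; nra.
have surj y : exists x, psi' x = y.
  (* Chosen so that [psi' u = psi a - |y| - |psi a| <= y] and [psi' v = psi b + |y| + |psi b| >= y];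
     the intermediate value theorem then applies. *)
  pose u := a - (`|y| + `|psi a|) / C; pose v := b + (`|y| + `|psi b|) / C.
  have [uC vC] : C * (u - a) = - (`|y| + `|psi a|) /\ C * (v - b) = `|y| + `|psi b|.
    by rewrite /u /v; split; field; rewrite gt_eqF.
  have ua : u <= a by rewrite gerBl divr_ge0// ?ltW// addr_ge0.
  have bv : b <= v by rewrite lerDl divr_ge0// ?ltW// addr_ge0.
  have pu : psi' u <= y.
    have -> : psi' u = psi a + C * (u - a) by rewrite /psi' /cl ua.
    by rewrite uC; have := lerNnormlW (lexx `|y|); have := ler_norm (psi a); lra.
  have pv : y <= psi' v.
    have -> : psi' v = psi b + C * (v - b).
      by rewrite /psi' /cl bv; case: leP => // va; have -> : a = b by lra.
    by rewrite vC; have := ler_norm y; have := lerNnormlW (lexx `|psi b|); lra.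
  have uv : u <= v by lra.
  have [|x _ xy] := @IVT R psi' u v y uv (continuous_subspaceT (lipschitz_continuous C0 psi'P)).
    by rewrite ge_min le_max pu pv orbT.
  by exists x.
rewrite integral_mkcond.
apply: (le_trans (lipschitz_substitution_onto C0 psi'P surj _ _)).
- by apply/measurable_restrict => //; exact: measurable_funS mh.
- by move=> x; exact: erestrict_ge0.
rewrite lee_pmul2l// [leRHS]integral_mkcond; apply: ge0_le_integralW => // x _.
- by apply: erestrict_ge0 => *; exact: h0.
- by apply: erestrict_ge0 => *; exact: h0.
rewrite /patch; case: ifPn => xcd; last by case: ifPn.
(* Outside [[a, b]] the positive slope sends [psi' x] below [psi a <= c] or above [psi b >= d], so
   such [x] cannot map into [[c, d]]. *)
have [xa|ax] := ltP x a.
  move: xcd; rewrite inE/= in_itv/= /psi'.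
  have -> : cl x = a by rewrite /cl (ltW xa).
  by move=> /andP[cx _]; exfalso; have : C * (x - a) < 0; [rewrite pmulr_rlt0// subr_lt0|lra].
have [bx|xb] := ltP b x.
  move: xcd; rewrite inE/= in_itv/= /psi'.
  have -> : cl x = b by rewrite /cl (ltW bx) leNgt (le_lt_trans ab bx).
  by move=> /andP[_ xd]; exfalso; have : 0 < C * (x - b); [rewrite mulr_gt0// subr_gt0|lra].
rewrite ifT ?inE/= ?in_itv/= ?ax//.
have -> : psi' x = psi x; last by [].
by rewrite /psi'; have -> : cl x = x; [rewrite /cl; case: (leP x a); case: (leP b x) => *; lra|ring].
Qed.

End substitution.

(** * Invariance of Lebesgue measure under rotations *)

(* [product_measure1] has no usable canonical sigma-finite instance: the one of
   [product_subprobability] is found first. *)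
Lemma product_measure1_sigma_finite d1 d2 (T1 : measurableType d1)
    (T2 : measurableType d2) (R : realType)
    (m1 : {sigma_finite_measure set T1 -> \bar R})
    (m2 : {sigma_finite_measure set T2 -> \bar R}) :
  sigma_finite setT (m1 \x m2)%E.
Proof.
have /sigma_finiteP[F [TF ndF Foo]] := sigma_finiteT m1.
have /sigma_finiteP[G [TG ndG Goo]] := sigma_finiteT m2.
exists (fun n => F n `*` G n).
  rewrite -setXTT TF TG predeqE => -[x y]; split.
    move=> [/= [n _ Fnx] [k _ Gky]]; exists (maxn n k) => //; split.
    - by move: x Fnx; exact/subsetPset/ndF/leq_maxl.
    - by move: y Gky; exact/subsetPset/ndG/leq_maxr.
  by move=> [n _ []/= ? ?]; split; exists n.
move=> k; have [? ?] := Foo k; have [? ?] := Goo k.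
split; first exact: measurableX.
by rewrite product_measure1E// lte_mul_pinfty// ge0_fin_numE.
Qed.

HB.instance Definition _ (R : realType) :=
  Measure.copy (leb2 R) (@lebesgue_measure R \x @lebesgue_measure R)%E.
HB.instance Definition _ (R : realType) := Measure_isSigmaFinite.Build _ _ _
  (leb2 R) (product_measure1_sigma_finite lebesgue_measure lebesgue_measure).

HB.instance Definition _ (R : realType) :=
  Measure.copy (leb3 R) (leb2 R \x @lebesgue_measure R)%E.
HB.instance Definition _ (R : realType) := Measure_isSigmaFinite.Build _ _ _
  (leb3 R) (product_measure1_sigma_finite (leb2 R) lebesgue_measure).

Section leb.
Variable R : realType.
Notation mu := (@lebesgue_measure R).
Local Open Scope ereal_scope.

Lemma integral_leb2 (F : R * R -> \bar R) :
  measurable_fun [set: R * R] F -> (forall z, 0 <= F z) ->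
  \int[leb2 R]_z F z = \int[mu]_y \int[mu]_x F (x, y).
Proof. by move=> mF F0; exact: (@fubini_tonelli2 _ _ _ _ _ mu mu F mF F0). Qed.

Lemma integral_leb2_swap (F : R * R -> \bar R) :
  measurable_fun [set: R * R] F -> (forall z, 0 <= F z) ->
  \int[leb2 R]_z F z = \int[mu]_x \int[mu]_y F (x, y).
Proof. by move=> mF F0; exact: (@fubini_tonelli1 _ _ _ _ _ mu mu F mF F0). Qed.

Lemma integral_leb3 (F : vec3 R -> \bar R) :
  measurable_fun [set: R * R * R] F -> (forall z, 0 <= F z) ->
  \int[leb3 R]_z F z = \int[mu]_z \int[leb2 R]_xy F (xy, z).
Proof.
move=> mF F0.
exact: (@fubini_tonelli2 _ _ _ _ _ (leb2 R) mu F mF F0).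
Qed.

Lemma integral_leb3_iter (F : vec3 R -> \bar R) :
  measurable_fun [set: R * R * R] F -> (forall z, 0 <= F z) ->
  \int[leb3 R]_z F z = \int[mu]_z \int[mu]_y \int[mu]_x F (x, y, z).
Proof.
move=> mF F0; rewrite integral_leb3//; apply: eq_integral => z _.
rewrite integral_leb2//.
by apply: measurableT_comp => //; exact: measurable_fun_pair.
Qed.

Lemma ge0_integral_shear1 (a : R) (F : R * R -> \bar R) :
  measurable_fun [set: R * R] F -> (forall z, 0 <= F z) ->
  \int[leb2 R]_z F (z.1 + a * z.2, z.2)%R = \int[leb2 R]_z F z.
Proof.
move=> mF F0.
rewrite !integral_leb2//=.
  apply: eq_integral => y _.
  rewrite (@ge0_integral_translation R (a * y) (fun x => F (x, y)))//.
  by apply: measurableT_comp => //; exact: measurable_fun_pair.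
apply: measurableT_comp => //; apply: measurable_fun_pair => //.
by apply: measurable_funD => //; apply: measurable_funM.
Qed.

Lemma ge0_integral_shear2 (a : R) (F : R * R -> \bar R) :
  measurable_fun [set: R * R] F -> (forall z, 0 <= F z) ->
  \int[leb2 R]_z F (z.1, z.2 + a * z.1)%R = \int[leb2 R]_z F z.
Proof.
move=> mF F0.
rewrite !integral_leb2_swap//=.
  apply: eq_integral => x _.
  rewrite (@ge0_integral_translation R (a * x) (fun y => F (x, y)))//.
  by apply: measurableT_comp => //; exact: measurable_fun_pair.
apply: measurableT_comp => //; apply: measurable_fun_pair => //.
by apply: measurable_funD => //; apply: measurable_funM.
Qed.

(* A rotation of angle t in ]-pi, pi[ is the product of three shears, with
   coefficients tan (t / 2), - sin t and tan (t / 2). *)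
Lemma ge0_integral_rotation (c s : R) (F : R * R -> \bar R) :
  (0 <= c)%R -> (c ^+ 2 + s ^+ 2 = 1)%R ->
  measurable_fun [set: R * R] F -> (forall z, 0 <= F z) ->
  \int[leb2 R]_z F (c * z.1 + s * z.2, c * z.2 - s * z.1)%R = \int[leb2 R]_z F z.
Proof.
move=> c0 cs mF F0.
have c1 : (1 + c != 0)%R by rewrite gt_eqF//; lra.
pose a := (s / (1 + c))%R.
have mS1 (G : R * R -> \bar R) : measurable_fun [set: R * R] G ->
    measurable_fun [set: R * R] (fun z => G (z.1 + a * z.2, z.2)%R).
  move=> mG; apply: measurableT_comp => //; apply: measurable_fun_pair => //.
  by apply: measurable_funD => //; apply: measurable_funM.
have mS2 (G : R * R -> \bar R) : measurable_fun [set: R * R] G ->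
    measurable_fun [set: R * R] (fun z => G (z.1, z.2 + (- s) * z.1)%R).
  move=> mG; apply: measurableT_comp => //; apply: measurable_fun_pair => //.
  by apply: measurable_funD => //; apply: measurable_funM.
rewrite -(ge0_integral_shear1 a mF F0).
rewrite -(ge0_integral_shear2 (- s) (mS1 _ mF))//.
rewrite -(ge0_integral_shear1 a (mS2 _ (mS1 _ mF)))//=.
apply: eq_integral => -[x y] _ /=; congr (F (_, _)).
- rewrite /a; have s2 : (s ^+ 2 = (1 - c) * (1 + c))%R by move: cs; lra.
  transitivity (x * (1 - s ^+ 2 / (1 + c)) + y * (s / (1 + c)) * (2%:R - s ^+ 2 / (1 + c)))%R; last by field.
  by rewrite s2; field.
- have s2 : (s ^+ 2 = (1 - c) * (1 + c))%R by move: cs; lra.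
  transitivity (y * (1 - s ^+ 2 / (1 + c)) - s * x)%R; last by rewrite /a; field.
  by rewrite s2; field.
Qed.

Lemma measurable_c1 : measurable_fun [set: vec3 R] (@c1 R).
Proof. exact: measurableT_comp. Qed.

Lemma measurable_c2 : measurable_fun [set: vec3 R] (@c2 R).
Proof. exact: measurableT_comp. Qed.

Lemma measurable_c3 : measurable_fun [set: vec3 R] (@c3 R).
Proof. exact: measurable_snd. Qed.

#[local] Hint Resolve measurable_c1 measurable_c2 measurable_c3 : core.

Lemma ge0_integral_rotation12 (c s : R) (F : vec3 R -> \bar R) :
  (0 <= c)%R -> (c ^+ 2 + s ^+ 2 = 1)%R ->
  measurable_fun [set: R * R * R] F -> (forall z, 0 <= F z) ->
  \int[leb3 R]_v F (c * c1 v + s * c2 v, c * c2 v - s * c1 v, c3 v)%R =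
  \int[leb3 R]_v F v.
Proof.
move=> c0 cs mF F0; rewrite !integral_leb3//=.
  apply: eq_integral => z _.
  rewrite -(@ge0_integral_rotation c s (fun xy => F (xy, z)))//.
  by apply: measurableT_comp => //; exact: measurable_fun_pair.
apply: measurableT_comp => //.
by apply: measurable_fun_pair => //; apply: measurable_fun_pair => //;
  [apply: measurable_funD => //|apply: measurable_funB => //]; exact: measurable_funM.
Qed.

(** With the middle coordinate outermost, a rotation of the first and third coordinates becomes a
    planar rotation under the integral. *)
Lemma integral_leb3_xz (F : vec3 R -> \bar R) :
  measurable_fun [set: R * R * R] F -> (forall z, 0 <= F z) ->
  \int[leb3 R]_v F v = \int[mu]_y \int[leb2 R]_xz F (xz.1, y, xz.2).
Proof.
move=> mF F0.
rewrite integral_leb3_iter//.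
rewrite -(@fubini_tonelli _ _ _ _ _ mu mu (fun yz => \int[mu]_x F (x, yz.1, yz.2)))/=.
- apply: eq_integral => y _; rewrite integral_leb2//.
  apply: measurableT_comp => //; apply: measurable_fun_pair => //.
  by apply: measurable_fun_pair => //.
- have mG : measurable_fun [set: (R * R) * R] (fun p => F (p.2, p.1.1, p.1.2)).
    apply: measurableT_comp => //.
    by do 2 apply: measurable_fun_pair => //; exact: measurableT_comp.
  exact: (@measurable_fun_fubini_tonelli_F _ _ _ _ _ mu _ mG).
- by move=> z; apply: integral_ge0.
Qed.

Lemma ge0_integral_rotation13 (c s : R) (F : vec3 R -> \bar R) :
  (0 <= c)%R -> (c ^+ 2 + s ^+ 2 = 1)%R ->
  measurable_fun [set: R * R * R] F -> (forall z, 0 <= F z) ->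
  \int[leb3 R]_v F (c * c1 v + s * c3 v, c2 v, c * c3 v - s * c1 v)%R =
  \int[leb3 R]_v F v.
Proof.
move=> c0 cs mF F0; rewrite !integral_leb3_xz//=.
  apply: eq_integral => y _.
  rewrite -(@ge0_integral_rotation c s (fun xz => F (xz.1, y, xz.2)))//.
  apply: measurableT_comp => //; apply: measurable_fun_pair => //.
  by apply: measurable_fun_pair => //.
apply: measurableT_comp => //.
apply: measurable_fun_pair => //; [apply: measurable_fun_pair => //|].
  by apply: measurable_funD => //; exact: measurable_funM.
by apply: measurable_funB => //; exact: measurable_funM.
Qed.

End leb.

(** * Rotation invariant densities *)

Section radial.
Variable R : realType.
Notation mu := (@lebesgue_measure R).

Lemma integral_leb3_iter_swap (F : vec3 R -> \bar R) :
  measurable_fun [set: R * R * R] F -> (forall z, 0 <= F z)%E ->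
  (\int[leb3 R]_z F z = \int[mu]_x \int[mu]_y \int[mu]_z F (x, y, z))%E.
Proof.
move=> mF F0.
rewrite (@fubini_tonelli1 _ _ _ _ _ (leb2 R) mu F mF F0).
rewrite integral_leb2_swap//.
  exact: (@measurable_fun_fubini_tonelli_F _ _ _ _ _ mu _ mF).
by move=> z; exact: integral_ge0.
Qed.

Lemma dot3_ge0 (x : vec3 R) : 0 <= dot3 x x.
Proof. by rewrite /dot3 -!expr2 !addr_ge0// sqr_ge0. Qed.

Lemma sqr_norm3 (x : vec3 R) : norm3 x ^+ 2 = dot3 x x.
Proof. by rewrite sqr_sqrtr// dot3_ge0. Qed.

Lemma norm3_ge0 (x : vec3 R) : 0 <= norm3 x.
Proof. exact: sqrtr_ge0. Qed.

(** Lagrange's identity: [Lmom] depends only on inner products. *)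
Lemma LmomE (x v : vec3 R) : Lmom x v = dot3 x x * dot3 v v - dot3 x v ^+ 2.
Proof. by rewrite /Lmom sqr_norm3 /dot3 /cross3 /c1 /c2 /c3/=; ring. Qed.

Lemma norm3_radial (r : R) : 0 <= r -> norm3 (radial_pt r) = r.
Proof.
by move=> r0; rewrite /norm3 /dot3 /c1 /c2 /c3/= !mulr0 !addr0 -expr2 sqrtr_sqr ger0_norm.
Qed.

Lemma Lmom_radial (r : R) (v : vec3 R) :
  Lmom (radial_pt r) v = r ^+ 2 * (c2 v ^+ 2 + c3 v ^+ 2).
Proof. by rewrite LmomE /dot3 /c1 /c2 /c3/=; ring. Qed.

(** Polar coordinates in the right half-plane, where the cosine is nonnegative, as required by the
    rotation lemmas. *)
Lemma polar_angle (p q : R) : 0 <= p -> exists c s, [/\ 0 <= c, c ^+ 2 + s ^+ 2 = 1,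
  p = Num.sqrt (p ^+ 2 + q ^+ 2) * c & q = Num.sqrt (p ^+ 2 + q ^+ 2) * s].
Proof.
move=> p0; set n := Num.sqrt _.
have n2 : n ^+ 2 = p ^+ 2 + q ^+ 2 by rewrite sqr_sqrtr// addr_ge0// sqr_ge0.
have [n0|n0] := eqVneq n 0.
  exists 1, 0; move: n2; rewrite n0 expr0n/= => /esym/eqP.
  rewrite paddr_eq0 ?sqr_ge0// !sqrf_eq0 => /andP[/eqP-> /eqP->].
  by split => //; ring.
exists (p / n), (q / n); split.
- by rewrite divr_ge0// sqrtr_ge0.
- by rewrite !expr_div_n -mulrDl -n2 divff// sqrf_eq0.
- by field.
- by field.
Qed.

(** A common form for the densities of both cases: the integrand sees [x] and [v] only through
    [|x|], [|v|^2] and [L], all invariant under a joint rotation. *)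
Definition dens (K : vec3 R -> R) (x : vec3 R) : \bar R :=
  (\int[leb3 R]_v (K (norm3 x, norm3 v ^+ 2, Lmom x v))%:E)%E.

Lemma measurable_sqrt : measurable_fun [set: R] (@Num.sqrt R).
Proof. by apply: continuous_measurable_fun; exact: sqrt_continuous. Qed.

Lemma measurable_fun_dot3 d (T : measurableType d) (f g : T -> vec3 R) :
  measurable_fun [set: _] f -> measurable_fun [set: _] g ->
  measurable_fun [set: _] (fun t => dot3 (f t) (g t)).
Proof.
move=> mf mg; rewrite /dot3.
have m1 h : measurable_fun [set: _] h -> measurable_fun [set: _] (fun t : T => c1 (h t)).
  by apply: measurableT_comp; exact: measurable_c1.
have m2 h : measurable_fun [set: _] h -> measurable_fun [set: _] (fun t : T => c2 (h t)).
  by apply: measurableT_comp; exact: measurable_c2.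
have m3 h : measurable_fun [set: _] h -> measurable_fun [set: _] (fun t : T => c3 (h t)).
  by apply: measurableT_comp; exact: measurable_c3.
by apply: measurable_funD; [apply: measurable_funD|]; apply: measurable_funM; auto.
Qed.

Lemma measurable_dens_integrand d (T : measurableType d) (K : vec3 R -> R)
    (f g : T -> vec3 R) : measurable_fun [set: _] K ->
  measurable_fun [set: _] f -> measurable_fun [set: _] g ->
  measurable_fun [set: _] (fun t => (K (norm3 (f t), norm3 (g t) ^+ 2, Lmom (f t) (g t)))%:E).
Proof.
move=> mK mf mg; apply/measurable_EFinP; apply: measurableT_comp => //.
apply: measurable_fun_pair; [apply: measurable_fun_pair|].
- exact: (measurableT_comp measurable_sqrt (measurable_fun_dot3 mf mf)).
- by under eq_fun do rewrite sqr_norm3; exact: measurable_fun_dot3.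
- under eq_fun do rewrite LmomE.
  apply: measurable_funB; first by apply: measurable_funM; exact: measurable_fun_dot3.
  by apply: measurable_funX; exact: measurable_fun_dot3.
Qed.

Lemma dens_ge0 (K : vec3 R -> R) x : (forall z, 0 <= K z) -> (0 <= dens K x)%E.
Proof. by move=> K0; apply: integral_ge0 => v _; rewrite lee_fin. Qed.

Lemma dens_radial (K : vec3 R -> R) (x : vec3 R) : measurable_fun [set: _] K ->
  (forall z, 0 <= K z) -> 0 <= c1 x -> dens K x = dens K (radial_pt (norm3 x)).
Proof.
move=> mK K0 x0.
(* Two rotations bring [x] to the first axis: one in the plane of coordinates 1 and 2 gives
   [(rho, 0, c3 x)], then one in the plane of coordinates 1 and 3 gives [(n, 0, 0)]. As [c1 x] and
   [rho] are nonnegative, so are both cosines. *)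
have [c [s [hc cs x1 x2]]] := polar_angle (c2 x) x0.
set rho := Num.sqrt _ in x1 x2.
have [c' [s' [hc' cs' r1 x3]]] := polar_angle (c3 x) (sqrtr_ge0 _ : 0 <= rho).
set n := Num.sqrt _ in r1 x3.
have nE : n = norm3 x.
  by rewrite /n /norm3 /rho sqr_sqrtr ?addr_ge0 ?sqr_ge0.
rewrite -nE /dens.
pose G (w : vec3 R) : \bar R := (K (norm3 (radial_pt n), norm3 w ^+ 2, Lmom (radial_pt n) w))%:E.
have mG : measurable_fun [set: _] G.
  by apply: measurable_dens_integrand => //; exact: measurable_cst.
have G0 z : (0 <= G z)%E by rewrite lee_fin.
rewrite -[RHS](ge0_integral_rotation13 hc' cs' mG G0).
rewrite -[RHS](ge0_integral_rotation12 hc cs).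
- apply: eq_integral => v _; rewrite /G; congr (K (_, _, _))%:E.
  + by rewrite norm3_radial ?nE// norm3_ge0.
  + rewrite !sqr_norm3 /dot3 /c1 /c2 /c3 /=.
    set v1 := v.1.1; set v2 := v.1.2; set v3 := v.2.
    (* The squared norm of the rotated vector, regrouped so that the sums [c^2 + s^2] and
       [c'^2 + s'^2] appear as factors and can be replaced by 1. *)
    transitivity ((c' ^+ 2 + s' ^+ 2) * ((c ^+ 2 + s ^+ 2) * v1 ^+ 2 + (c ^+ 2 + s ^+ 2) * v2 ^+ 2 - (c * v2 - s * v1) ^+ 2 + v3 ^+ 2) + (c * v2 - s * v1) ^+ 2); last by ring.
    by rewrite cs cs'; ring.
  + rewrite Lmom_radial LmomE -sqr_norm3 -nE.
    have -> : dot3 x v = n * (c' * (c * c1 v + s * c2 v) + s' * c3 v).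
      by rewrite /dot3 x1 x2 r1 x3; ring.
    rewrite /dot3 /c1 /c2 /c3 /=.
    set v1 := v.1.1; set v2 := v.1.2; set v3 := v.2.
    transitivity (n ^+ 2 * ((c' ^+ 2 + s' ^+ 2) * ((c ^+ 2 + s ^+ 2) * v1 ^+ 2 + (c ^+ 2 + s ^+ 2) * v2 ^+ 2 - (c * v2 - s * v1) ^+ 2 + v3 ^+ 2) + (c * v2 - s * v1) ^+ 2 - (c' * (c * v1 + s * v2) + s' * v3) ^+ 2)); last by ring.
    by rewrite cs cs'; ring.
- apply: measurableT_comp => //; apply: measurable_fun_pair; [apply: measurable_fun_pair|] => //.
  + by apply: measurable_funD; apply: measurable_funM => //; [exact: measurable_c1|exact: measurable_c3].
  + exact: measurable_c2.
  + by apply: measurable_funB; apply: measurable_funM => //; [exact: measurable_c3|exact: measurable_c1].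
- by move=> z; exact: G0.
Qed.

End radial.

(** * Radial integrals bounded by integrals over space *)

Section bounds.
Variable R : realType.
Notation mu := (@lebesgue_measure R).

(** For the upper bound put [t = sqrt (x^2 + A) >= x]; then [(t + (y - x))^2] exceeds [y^2 + A] by
    [2 (t - x) (y - x) >= 0]. *)
Lemma sqrt_sqrD_lipschitz (A x y : R) : 0 <= A -> 0 <= x -> x <= y ->
  Num.sqrt (x ^+ 2 + A) <= Num.sqrt (y ^+ 2 + A) <= Num.sqrt (x ^+ 2 + A) + 1 * (y - x).
Proof.
move=> A0 x0 xy; have xA : 0 <= x ^+ 2 + A by rewrite addr_ge0// sqr_ge0.
have xs : x <= Num.sqrt (x ^+ 2 + A).
  by rewrite -{1}(ger0_norm x0) -sqrtr_sqr ler_wsqrtr// lerDl.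
have s2 := sqr_sqrtr xA.
apply/andP; split; first by rewrite ler_wsqrtr// lerD2r lerXn2r// nnegrE; lra.
rewrite -[leRHS]ger0_norm; last by rewrite addr_ge0 ?sqrtr_ge0//; lra.
rewrite -sqrtr_sqr ler_wsqrtr//; set t := Num.sqrt _ in xs s2 *.
have h : 0 <= (t - x) * (y - x) by rewrite mulr_ge0// subr_ge0.
nra.
Qed.

Lemma measurable_norm3 : measurable_fun [set: vec3 R] (@norm3 R).
Proof. exact: (measurableT_comp (@measurable_sqrt R) (measurable_fun_dot3 _ _)). Qed.

Lemma measurable_triangle d (T : measurableType d) (f g : T -> R) :
  measurable_fun [set: T] f -> measurable_fun [set: T] g ->
  measurable_fun [set: T]
    (fun t => if (0 <= g t) && (g t <= f t / 2) then 1 else 0 : R).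
Proof.
move=> mf mg; apply: measurable_fun_ifT => //; apply: measurable_and.
  exact: measurable_fun_ler.
by apply: measurable_fun_ler => //; exact: measurable_funM.
Qed.

Lemma integral_triangle (s : R) : 0 <= s ->
  (\int[mu]_y (if (0 <= y) && (y <= s / 2) then 1 else 0 : R)%:E = (s / 2)%:E)%E.
Proof.
move=> s0; transitivity (\int[mu]_y (\1_(`[0%R, (s / 2)%R]%classic) y)%:E)%E.
  apply: eq_integral => y _; rewrite indicE; congr EFin.
  have -> : (y \in `[0%R, s / 2]%classic) = (0 <= y) && (y <= s / 2).
    by apply/idP/idP; rewrite inE/= in_itv.
  by case: ifP.
rewrite integral_indic// setIT [LHS](lebesgue_measure_itv `[_, _])/= lte_fin.
by case: ltP => [_|h]; rewrite ?sube0//; congr EFin; lra.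
Qed.

(* For fixed [y, z] the map [x |-> |(x, y, z)|] is 1-Lipschitz, so the integral
   of [g (|(x, y, z)|)] over [x] dominates that of [g s] over [s >= |(0, y, z)|];
   the factor [s ^+ 2 / 4] is the area of the square [0, s / 2] ^ 2. *)
Lemma radial_integral_le (g : R -> \bar R) (F : vec3 R -> \bar R) (r : R) :
  measurable_fun [set: R] g -> (forall s, 0 <= g s)%E -> (forall x, 0 <= F x)%E ->
  (forall x, 0 <= c1 x -> F x = g (norm3 x)) -> 0 <= r ->
  (\int[mu]_(s in `[0%R, r]) ((s ^+ 2)%:E * g s) <= 4%:E * \int[leb3 R]_x F x)%E.
Proof.
move=> mg g0 F0 Fg r0.
(* The radial form of [F] is known only on the half-space of nonnegative first coordinate, so the
   rest of space is discarded. *)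
pose H (x : vec3 R) : \bar R := if 0 <= c1 x then g (norm3 x) else 0%E.
have H0 x : (0 <= H x)%E by rewrite /H; case: ifP.
have mH : measurable_fun [set: R * R * R] H.
  apply: measurable_fun_ifT => //.
    by apply: measurable_fun_ler => //; exact: measurable_c1.
  by apply: measurableT_comp => //; exact: measurable_norm3.
have HF : (\int[leb3 R]_x H x <= \int[leb3 R]_x F x)%E.
  apply: ge0_le_integralW => // x _; rewrite /H; case: ifPn => // h.
  by rewrite Fg.
apply: le_trans (lee_wpmul2l _ HF) => //.
(* If [y] and [z] lie in [[0, s / 2]], then [sqrt (y^2 + z^2) <= s], so [s] is in the range of the
   substitution below. *)
pose chi (s y : R) : R := if (0 <= y) && (y <= s / 2) then 1 else 0.
have chi0 s y : 0 <= chi s y by rewrite /chi; case: ifP.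
have chi1 s : measurable_fun [set: R] (fun y => (chi s y)%:E).
  by apply/measurable_EFinP; exact: measurable_triangle.
pose g' := (g \_ `[0%R, r])%E.
have mg' : measurable_fun [set: R] g'.
  by apply/measurable_restrict => //; exact: measurable_funS mg.
have g'0 s : (0 <= g' s)%E by apply: erestrict_ge0 => *; exact: g0.
(* The first coordinate of [Q] plays the radius [s]. Integrated first over [s] at fixed [y, z], [Q]
   is dominated by [H]; integrated last over [s], it yields [g s * (s / 2)^2]. *)
pose Q (p : vec3 R) : \bar R := (g' (c1 p) * ((chi (c1 p) (c2 p))%:E * (chi (c1 p) (c3 p))%:E))%E.
have Q0 p : (0 <= Q p)%E by rewrite /Q !mule_ge0// lee_fin.
have mQ : measurable_fun [set: R * R * R] Q.
  apply: emeasurable_funM.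
    by apply: measurableT_comp => //; exact: measurable_c1.
  apply: emeasurable_funM; apply/measurable_EFinP.
    by apply: measurable_triangle; [exact: measurable_c1|exact: measurable_c2].
  by apply: measurable_triangle; [exact: measurable_c1|exact: measurable_c3].
have QH : (\int[leb3 R]_x Q x <= \int[leb3 R]_x H x)%E.
  rewrite (integral_leb3_iter mQ Q0) (integral_leb3_iter mH H0).
  apply: ge0_le_integralW => [//|z _|z _|z _]; [by do 2 apply: integral_ge0 => *..|].
  apply: ge0_le_integralW => [//|y _|y _|y _]; [exact: integral_ge0..|].
  rewrite /Q /c1 /c2 /c3 /=.
  have [|yz] := boolP ((0 <= y) && (0 <= z)); last first.
    rewrite integral0_eq; first exact: integral_ge0.
    move=> s _; rewrite /chi; case: (0 <= y) yz => //=; last by rewrite mul0e mule0.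
    by case: (0 <= z) => //= _; rewrite !mule0.
  move=> /andP[y0 z0].
  have A0 : 0 <= y ^+ 2 + z ^+ 2 by rewrite addr_ge0// sqr_ge0.
  have := @lipschitz_substitution R (fun x => Num.sqrt (x ^+ 2 + (y ^+ 2 + z ^+ 2))) 0 r
    (Num.sqrt (y ^+ 2 + z ^+ 2)) r 1 g ltr01 r0.
  move=> /(_ _ _ _ mg g0); rewrite mul1e => sub.
  apply: (@le_trans _ _ (\int[mu]_(s in `[(Num.sqrt (y ^+ 2 + z ^+ 2))%R, r]) g s)%E).
    rewrite [leRHS]integral_mkcond; apply: ge0_le_integralW => // s _.
    - by rewrite !mule_ge0// lee_fin.
    - by apply: erestrict_ge0 => *; exact: g0.
    rewrite /g' /chi /patch; case: ifPn => [sr|_]; last first.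
      by rewrite mul0e; case: ifP.
    rewrite y0 z0 /=; move: sr; rewrite inE/= in_itv/= => /andP[s0 sr].
    case: (leP y (s / 2)) => ys; last by rewrite mul0e mule0; case: ifP.
    case: (leP z (s / 2)) => zs; last by rewrite mule0 mule0; case: ifP.
    rewrite ifT ?mul1e ?mule1// inE/= in_itv/= sr andbT.
    rewrite -[leRHS]ger0_norm// -sqrtr_sqr ler_wsqrtr//; nra.
  apply: le_trans (sub _ _ _) _.
  - by move=> x x' x0 xx' _; exact: sqrt_sqrD_lipschitz.
  - by rewrite expr0n/= add0r.
  - by rewrite -{1}(ger0_norm r0) -sqrtr_sqr ler_wsqrtr// lerDl.
  apply: ge0_le_integralW => // x; rewrite /= in_itv/= => /andP[x0 _].
  rewrite /H /c1/= x0; suff -> : norm3 (x, y, z) = Num.sqrt (x ^+ 2 + (y ^+ 2 + z ^+ 2)) by [].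
  by congr (Num.sqrt _); rewrite /dot3 /c1 /c2 /c3/=; ring.
apply: le_trans (lee_wpmul2l _ QH) => //.
rewrite (integral_leb3_iter_swap mQ Q0).
rewrite -ge0_integralZl//; last 2 first.
- have mQ1 := @measurable_fun_fubini_tonelli_F _ _ _ _ _ mu _ mQ Q0.
  apply: (@measurable_fun_fubini_tonelli_F _ _ _ _ _ mu _ mQ1) => xy.
  exact: integral_ge0.
- by move=> x _; do 2 apply: integral_ge0 => // *.
rewrite [leLHS]integral_mkcond; apply: ge0_le_integralW => // s _.
- by apply: erestrict_ge0 => *; rewrite mule_ge0// lee_fin sqr_ge0.
- by rewrite mule_ge0//; do 2 apply: integral_ge0 => // *.
rewrite /patch; case: ifPn; last by move=> _; rewrite mule_ge0//; do 2 apply: integral_ge0 => // *.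
rewrite inE/= => sr; have /andP[s0 _] : 0 <= s <= r by move: sr; rewrite in_itv.
have -> : (\int[mu]_y \int[mu]_z Q (s, y, z) = g s * ((s / 2)%:E * (s / 2)%:E))%E.
  transitivity (\int[mu]_y (g s * (s / 2)%:E * (chi s y)%:E))%E.
    apply: eq_integral => y _; rewrite /Q /c1 /c2 /c3/=.
    rewrite /g' /patch ifT ?inE//.
    under eq_integral do rewrite muleA.
    rewrite (ge0_integralZl mu measurableT (chi1 s))//; last 2 first.
    - by move=> *; rewrite lee_fin.
    - by rewrite mule_ge0// lee_fin.
    by rewrite integral_triangle// -!muleA; congr (_ * _)%E; rewrite muleC.
  rewrite (ge0_integralZl mu measurableT (chi1 s))//; last 2 first.
  - by move=> *; rewrite lee_fin.
  - by rewrite mule_ge0// lee_fin divr_ge0.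
  by rewrite integral_triangle// muleA.
rewrite -EFinM muleCA -EFinM muleC.
by rewrite (_ : 4 * (s / 2 * (s / 2)) = s ^+ 2)//; field.
Qed.

End bounds.

(** * Lower bound of the density by the phase-space integral over a box *)

Section box.
Variable R : realType.
Notation mu := (@lebesgue_measure R).

Definition box (E0 E1 L0 L1 : R) : set (R * R) := `[E0, E1]%classic `*` `[L0, L1]%classic.

Lemma integral_box (Phi : R * R -> R) (E0 E1 L0 L1 : R) :
  measurable_fun [set: _] Phi -> (forall z, 0 <= Phi z) ->
  (\int[leb2 R]_(z in box E0 E1 L0 L1) (Phi z)%:E =
   \int[mu]_(L in `[L0, L1]) \int[mu]_(E in `[E0, E1]) (Phi (E, L))%:E)%E.
Proof.
move=> mPhi Phi0.
rewrite integral_mkcond integral_leb2; last 2 first.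
- apply/measurable_restrict => //; first exact: measurableX.
  by apply/measurable_EFinP; exact: measurable_funS mPhi.
- by move=> z; apply: erestrict_ge0 => *; rewrite lee_fin.
rewrite [RHS]integral_mkcond; apply: eq_integral => L _.
rewrite [RHS]/patch; case: ifPn => hL.
  rewrite [RHS]integral_mkcond; apply: eq_integral => E _; rewrite /patch.
  have -> : ((E, L) \in box E0 E1 L0 L1) = (E \in `[E0, E1]%classic); last by [].
  by rewrite inE in hL; apply/idP/idP; rewrite !inE; [case|split].
rewrite integral0_eq// => E _; rewrite /patch ifF//.
by apply: contraNF hL; rewrite !inE => -[].
Qed.

(** [psi L x] is the energy at radius [s] for radial velocity [x] and angular momentum [L], where
    [|v|^2 = x^2 + L / s^2]. The hypotheses say that for every [L] in the box, radial velocities in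
    [[0, b]] reach all of [[E0, E1]] at Lipschitz rate [C]. *)
Lemma density_box_bound (K : vec3 R -> R) (Phi : R * R -> R) (psi : R -> R -> R)
    (s C b E0 E1 L0 L1 : R) :
  measurable_fun [set: _] K -> (forall z, 0 <= K z) ->
  measurable_fun [set: _] Phi -> (forall z, 0 <= Phi z) ->
  0 < s -> 0 < C -> 0 <= b -> 0 < L0 -> L0 <= L1 ->
  (forall L, L0 <= L <= L1 -> forall x y, 0 <= x -> x <= y -> y <= b ->
     psi L x <= psi L y <= psi L x + C * (y - x)) ->
  (forall L, L0 <= L <= L1 -> psi L 0 <= E0 /\ E1 <= psi L b) ->
  (forall L x, L0 <= L <= L1 -> 0 <= x ->
     Phi (psi L x, L) <= K (s, x ^+ 2 + L / s ^+ 2, L)) ->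
  ((Num.sqrt L0)%:E * \int[leb2 R]_(z in box E0 E1 L0 L1) (Phi z)%:E <=
   (2 * C * Num.sqrt L1 * s ^+ 2)%:E * dens K (radial_pt s))%E.
Proof.
move=> mK K0 mPhi Phi0 s0 C0 b0 L00 L01 psiP psi0b PhiK.
have L10 : 0 < L1 by lra.
have sL1 : 0 < Num.sqrt L1 by rewrite sqrtr_gt0.
have sL0 : 0 < Num.sqrt L0 by rewrite sqrtr_gt0.
rewrite integral_box//; set I := (\int[mu]_(L in _) _)%E.
have mPhiE L : measurable_fun [set: R] (fun E => (Phi (E, L))%:E).
  apply/measurable_EFinP; apply: (measurableT_comp mPhi).
  exact: measurable_fun_pair.
pose q0 L := (\int[mu]_E ((fun E => (Phi (E, L))%:E) \_ `[E0, E1]) E)%E.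
have mq0 : measurable_fun [set: R] q0.
  pose f (p : R * R) := (((fun z => (Phi z)%:E) \_ (`[E0, E1]%classic `*` [set: R])) p)%E.
  have mf : measurable_fun [set: R * R] f.
    apply/measurable_restrict => //; first exact: measurableX.
    by apply/measurable_EFinP; exact: measurable_funS mPhi.
  have f0 z : (0 <= f z)%E by apply: erestrict_ge0 => *; rewrite lee_fin.
  have := @measurable_fun_fubini_tonelli_G _ _ _ _ _ mu f mf f0.
  apply: eq_measurable_fun => L _; apply: eq_integral => E _.
  rewrite /f /patch; congr (if _ then _ else _).
  by apply/idP/idP; rewrite !inE; [case|split].
have q0_ge0 L : (0 <= q0 L)%E.
  by apply: integral_ge0 => E _; apply: erestrict_ge0 => *; rewrite lee_fin.
pose q := (q0 \_ `[L0, L1])%E.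
have mq : measurable_fun [set: R] q.
  by apply/measurable_restrict => //; exact: measurable_funS mq0.
have q_ge0 L : (0 <= q L)%E by apply: erestrict_ge0 => *; exact: q0_ge0.
have IE : I = (\int[mu]_(L in `[L0, L1]) q L)%E.
  apply: eq_integral => L hL; rewrite /q /patch hL /q0.
  by rewrite integral_mkcond.
have I0 : (0 <= I)%E by rewrite IE; exact: integral_ge0.
(* Product of the two Lipschitz constants: [C] for the passage from [x] to the energy,
   [2 * s * Num.sqrt L1] for the passage from [y] to [L]. *)
pose D := 2 * s * Num.sqrt L1 * C.
have D0 : 0 <= D by rewrite /D !mulr_ge0// ltW.
pose F (v : vec3 R) := (D%:E * (K (norm3 (radial_pt s), norm3 v ^+ 2, Lmom (radial_pt s) v))%:E)%E.
have mKs : measurable_fun [set: vec3 R] (fun v => (K (norm3 (radial_pt s), norm3 v ^+ 2, Lmom (radial_pt s) v))%:E).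
  by apply: measurable_dens_integrand => //; exact: measurable_cst.
have mF : measurable_fun [set: R * R * R] F by exact: measurable_funeM.
have F0 v : (0 <= F v)%E by rewrite /F -EFinM lee_fin mulr_ge0.
(* Energy substitution: fixing [y] and [z] fixes [L = s^2 (y^2 + z^2)]. *)
have step1 y z : ((2 * s * Num.sqrt L1)%:E * q (s ^+ 2 * (y ^+ 2 + z ^+ 2))%R <= \int[mu]_x F (x, y, z))%E.
  set L := s ^+ 2 * _; rewrite /q /patch; case: ifPn; last first.
    by move=> _; rewrite mule0; exact: integral_ge0.
  rewrite inE/= in_itv/= => hL.
  rewrite /F ge0_integralZl//; last 2 first.
  - by apply: (measurableT_comp mKs); exact: measurable_fun_pair.
  - by move=> x _; rewrite lee_fin.
  rewrite /D (EFinM _ C) -muleA lee_wpmul2l//; first by rewrite lee_fin !mulr_ge0// ltW.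
  rewrite /q0 -integral_mkcond.
  have [h1 h2] := psi0b _ hL.
  have Phi1 x : (0 <= (Phi (x, L))%:E)%E by rewrite lee_fin.
  apply: le_trans (lipschitz_substitution C0 b0 (psiP _ hL) h1 h2 (mPhiE L) Phi1) _.
  rewrite lee_wpmul2l ?lee_fin ?(ltW C0)//.
  apply: ge0_le_integralW => [//|x _|x _|x]; rewrite ?lee_fin//= in_itv/= => /andP[x0 _].
  apply: le_trans (PhiK _ _ hL x0) _.
  rewrite (norm3_radial (ltW s0)) Lmom_radial sqr_norm3 /dot3 /c1 /c2 /c3/= -/L.
  suff -> : x ^+ 2 + L / s ^+ 2 = x * x + y * y + z * z by [].
  by rewrite /L; field; rewrite gt_eqF.
(* On [[0, sqrt L1 / s]] the map [y |-> s^2 (y^2 + z^2)] has slope at most [2 s sqrt L1]; the bound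
   on [z] makes it start at or below [L0], and it ends at or above [L1]. *)
have step2 z : 0 <= z <= Num.sqrt L0 / s -> (I <= \int[mu]_y \int[mu]_x F (x, y, z))%E.
  move=> /andP[z0 zL]; rewrite IE.
  have b'0 : 0 <= Num.sqrt L1 / s by rewrite divr_ge0// ltW.
  have C'0 : 0 < 2 * s * Num.sqrt L1 by rewrite !mulr_gt0.
  have b's : Num.sqrt L1 / s * s = Num.sqrt L1 by rewrite divfK// gt_eqF.
  have zs : z * s <= Num.sqrt L0 by rewrite -ler_pdivlMr.
  have := @lipschitz_substitution R (fun y => s ^+ 2 * (y ^+ 2 + z ^+ 2)) 0 (Num.sqrt L1 / s)
    L0 L1 (2 * s * Num.sqrt L1) q C'0 b'0 _ _ _ mq q_ge0.
  have sq0 := sqr_sqrtr (ltW L00); have sq1 := sqr_sqrtr (ltW L10).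
  have zs0 : 0 <= z * s by rewrite mulr_ge0// ltW.
  have zsL : (z * s) ^+ 2 <= L0 by nra.
  have zsE : (z * s) ^+ 2 = s ^+ 2 * z ^+ 2 by ring.
  move=> sub; apply: le_trans (sub _ _ _) _ => {sub}.
  - move=> x y x0 xy yb.
    have ys : y * s <= Num.sqrt L1 by rewrite -ler_pdivlMr.
    apply/andP; split.
      by rewrite ler_wpM2l ?sqr_ge0// lerD2r lerXn2r ?nnegrE// (le_trans x0 xy).
    rewrite -subr_ge0.
    have -> : s ^+ 2 * (x ^+ 2 + z ^+ 2) + 2 * s * Num.sqrt L1 * (y - x) -
      s ^+ 2 * (y ^+ 2 + z ^+ 2) = s * (y - x) * ((Num.sqrt L1 - y * s) + (Num.sqrt L1 - x * s)) by ring.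
    have xs : x * s <= y * s by rewrite ler_wpM2r// ltW.
    by apply: mulr_ge0; [apply: mulr_ge0|]; lra.
  - by rewrite expr0n/= add0r -zsE.
  - have -> : s ^+ 2 * ((Num.sqrt L1 / s) ^+ 2 + z ^+ 2) = (Num.sqrt L1 / s * s) ^+ 2 + (z * s) ^+ 2 by ring.
    by rewrite b's sq1 lerDl sqr_ge0.
  rewrite -ge0_integralZl//; last 2 first.
  - apply: measurable_funTS; apply: (measurableT_comp mq).
    by apply: measurable_funM => //; exact: measurable_funD.
  - by rewrite lee_fin ltW.
  apply: ge0_le_integralW => // y _.
  - by rewrite mule_ge0// lee_fin ltW.
  - exact: integral_ge0.
have dE : ((2 * s * Num.sqrt L1 * C)%:E * dens K (radial_pt s) = \int[mu]_z \int[mu]_y \int[mu]_x F (x, y, z))%E.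
  rewrite -(integral_leb3_iter mF F0) /F ge0_integralZl//.
  by move=> v _; rewrite lee_fin.
have step3 : ((Num.sqrt L0 / s)%:E * I <= (2 * s * Num.sqrt L1 * C)%:E * dens K (radial_pt s))%E.
  rewrite dE.
  apply: (@le_trans _ _ (\int[mu]_(z in `[0%R, (Num.sqrt L0 / s)%R]) I)%E).
    rewrite integral_cst//= [X in (_ <= _ * X)%E](lebesgue_measure_itv `[_, _])/= lte_fin.
    by rewrite divr_gt0// oppr0 adde0 muleC.
  apply: ge0_le_integralW => [//|//|z _|z]; first by do 2 apply: integral_ge0 => // *.
  by rewrite /= in_itv/=; exact: step2.
have -> : Num.sqrt L0 = s * (Num.sqrt L0 / s) by field; rewrite gt_eqF//.
have -> : 2 * C * Num.sqrt L1 * s ^+ 2 = s * (2 * s * Num.sqrt L1 * C) by ring.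
by rewrite !(EFinM s) -!muleA lee_wpmul2l// lee_fin ltW.
Qed.

End box.

(** * From finite mass to almost everywhere vanishing *)

Section vanishing.
Variable R : realType.
Notation mu := (@lebesgue_measure R).

Lemma measurable_dens_radial (K : vec3 R -> R) :
  measurable_fun [set: _] K -> (forall z, 0 <= K z) ->
  measurable_fun [set: R] (fun s => dens K (radial_pt s)).
Proof.
move=> mK K0.
pose F (p : R * vec3 R) := (K (norm3 (radial_pt p.1), norm3 p.2 ^+ 2, Lmom (radial_pt p.1) p.2))%:E.
have mF : measurable_fun [set: R * vec3 R] F.
  apply: measurable_dens_integrand => //.
  by apply: measurable_fun_pair => //; exact: measurable_fun_pair.
apply: (@measurable_fun_fubini_tonelli_F _ _ _ _ _ (leb3 R) F mF).
by move=> z; rewrite lee_fin.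
Qed.

Lemma dens_mass_le (K : vec3 R -> R) (r : R) :
  measurable_fun [set: _] K -> (forall z, 0 <= K z) -> 0 <= r ->
  (\int[mu]_(s in `[0%R, r]) ((s ^+ 2)%:E * dens K (radial_pt s)) <=
   4%:E * \int[leb3 R]_x dens K x)%E.
Proof.
move=> mK K0 r0.
apply: (@radial_integral_le R (fun s => dens K (radial_pt s)) (dens K)) => //.
- exact: measurable_dens_radial.
- by move=> s; exact: dens_ge0.
- by move=> x; exact: dens_ge0.
- by move=> x; exact: dens_radial.
Qed.

(** Integrating the lower bound over radii in [[s0, s0 + t]] gives [J * t <= 4 M] for every
    [t >= 0], which forces [J = 0]. *)
Lemma eq0_of_finite_mass (K : vec3 R -> R) (s0 : R) (J : \bar R) :
  measurable_fun [set: _] K -> (forall z, 0 <= K z) -> 0 <= s0 -> (0 <= J)%E ->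
  (forall s, s0 <= s -> (J <= (s ^+ 2)%:E * dens K (radial_pt s))%E) ->
  (\int[leb3 R]_x dens K x < +oo)%E -> J = 0%E.
Proof.
move=> mK K0 s00 J0 Jle Moo; apply/eqP; rewrite eq_le J0 andbT leNgt; apply/negP => Jgt.
have M0 : (0 <= \int[leb3 R]_x dens K x)%E by apply: integral_ge0 => *; exact: dens_ge0.
have h (t : R) : 0 <= t -> (J * t%:E <= 4%:E * \int[leb3 R]_x dens K x)%E.
  move=> t0; apply: le_trans (@dens_mass_le K (s0 + t) mK K0 _); last by rewrite addr_ge0.
  have -> : (J * t%:E = \int[mu]_(s in `[s0, (s0 + t)%R]) J)%E.
    rewrite integral_cst//= [X in (_ = _ * X)%E](lebesgue_measure_itv `[_, _])/= lte_fin.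
    case: ltP => ht; first by rewrite -EFinB; congr (_ * _%:E)%E; ring.
    by congr (_ * _%:E)%E; lra.
  apply: ge0_le_integralW => [x|//|x _|x].
  - by rewrite /= !in_itv/= => /andP[sx ->]; rewrite (le_trans s00 sx).
  - by rewrite mule_ge0 ?dens_ge0// lee_fin sqr_ge0.
  - by rewrite /= in_itv/= => /andP[/Jle].
move: M0 Moo h; case: (\int[leb3 R]_x dens K x)%E => [M| |]// M0 _ h.
move: Jgt Jle h J0; case: J => [j| |]//; last first.
  by move=> _ _ /(_ 1 ler01) + _; rewrite mule1 -EFinM.
rewrite lte_fin => j0 _ h _.
(* This length yields the contradiction [4 M + 1 <= 4 M]; an infinite [J] was excluded by length
   1. *)
have := h ((4 * M + 1) / j).
rewrite -!EFinM lee_fin; have -> : j * ((4 * M + 1) / j) = 4 * M + 1 by field; rewrite gt_eqF.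
rewrite lee_fin in M0; move=> /(_ _); have -> : 0 <= (4 * M + 1) / j.
  by rewrite divr_ge0 ?(ltW j0)//; lra.
by move=> /(_ isT); lra.
Qed.

Lemma ae_eq0_boxes (Phi : R * R -> R) (einf : R) :
  measurable_fun [set: _] Phi -> (forall z, 0 <= Phi z) ->
  (forall E0 E1 L0 L1, einf < E0 -> 0 < L0 -> L0 <= L1 ->
     (\int[leb2 R]_(z in box E0 E1 L0 L1) (Phi z)%:E = 0)%E) ->
  {ae leb2 R, forall z : R * R, einf < z.1 -> 0 < z.2 -> Phi z = 0}.
Proof.
move=> mPhi Phi0 hbox.
(* Countably many boxes exhausting the region [E > einf], [L > 0]; the first ones may be empty. On
   each, a nonnegative function with zero integral vanishes almost everywhere. *)
pose B n := box (einf + n.+1%:R^-1) n.+1%:R n.+1%:R^-1 n.+1%:R.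
have mB n : measurable (B n : set (R * R)) by exact: measurableX.
have aeB n : {ae leb2 R, forall z : R * R, B n z -> Phi z = 0}.
  have mPhiB : measurable_fun (B n) (EFin \o Phi).
    by apply/measurable_EFinP; exact: measurable_funS mPhi.
  have n0 : 0 < n.+1%:R^-1 :> R by rewrite invr_gt0.
  have := hbox (einf + n.+1%:R^-1) n.+1%:R n.+1%:R^-1 n.+1%:R.
  rewrite ltrDl n0 => /(_ isT isT) hb.
  have n1 : n.+1%:R^-1 <= n.+1%:R :> R.
    by rewrite (@le_trans _ _ 1)// ?invf_le1 ?ler1n.
  have [+ _] := @ae_eq_integral_abs _ _ _ (leb2 R) (B n) (mB n) (EFin \o Phi) mPhiB.
  have -> : (\int[leb2 R]_(x in B n) `|(EFin \o Phi) x| = 0)%E.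
    rewrite -(hb n1); apply: eq_integral => z _ /=.
    by rewrite ger0_norm.
  move=> /(_ erefl); apply: filterS => z /= hz /hz.
  by move=> [].
have := ae_foralln aeB; apply: filterS => z hz z1 z2.
have z10 : 0 < z.1 - einf by rewrite subr_gt0.
near \oo => n.
have zn : z.1 <= n.+1%:R /\ z.2 <= n.+1%:R.
  split; apply: (@le_trans _ _ n%:R); rewrite ?ler_nat//;
  by near: n; exact: nbhs_infty_ger.
apply: (hz n); split; rewrite /= in_itv/= ?zn.1 ?zn.2 andbT.
- rewrite -lerBrDl ltW//.
  by near: n; exact: (near_infty_natSinv_lt (PosNum z10)).
- rewrite ltW//.
  by near: n; exact: (near_infty_natSinv_lt (PosNum z2)).
Unshelve. all: by end_near. Qed.

End vanishing.

(** * Vanishing criterion for a general energy, and monotone limits *)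

Section kinetic.
Variable R : realType.

(** Serves both cases: [e s n] is the energy at radius [s] with [|v|^2 = n], and [A] is the squared
    tangential velocity [L / s^2]. It is essential that [C] and [b] do not depend on [s]: the lower
    bound on [s^2] times the density is then uniform for [s >= s0]. *)
Lemma vanishing_of_finite_mass (K : vec3 R -> R) (Phi : R * R -> R) (e : R -> R -> R) (einf : R) :
  measurable_fun [set: _] K -> (forall z, 0 <= K z) ->
  measurable_fun [set: _] Phi -> (forall z, 0 <= Phi z) ->
  (forall s n L, 0 < s -> 0 <= n -> Phi (e s n, L) <= K (s, n, L)) ->
  (forall E0 E1 L1, einf < E0 -> 0 < L1 -> exists s0 C b, [/\ 0 < s0, 0 < C, 0 <= b &
     forall s A, s0 <= s -> 0 <= A <= L1 / s ^+ 2 ->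
       [/\ forall x y, 0 <= x -> x <= y -> y <= b ->
            e s (x ^+ 2 + A) <= e s (y ^+ 2 + A) <= e s (x ^+ 2 + A) + C * (y - x),
           e s A <= E0 & E1 <= e s (b ^+ 2 + A)]]) ->
  (\int[leb3 R]_x dens K x < +oo)%E ->
  {ae leb2 R, forall z : R * R, einf < z.1 -> 0 < z.2 -> Phi z = 0}.
Proof.
move=> mK K0 mPhi Phi0 PhiK He Moo; apply: ae_eq0_boxes => // E0 E1 L0 L1 hE0 hL0 L01.
have L10 : 0 < L1 by exact: lt_le_trans L01.
have [s0 [C [b [s00 C0 b0 H]]]] := He E0 E1 L1 hE0 L10.
have sL0 : 0 < Num.sqrt L0 by rewrite sqrtr_gt0.
have sL1 : 0 < Num.sqrt L1 by rewrite sqrtr_gt0.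
set I := (\int[_]_(_ in _) _)%E.
have I0 : (0 <= I)%E by apply: integral_ge0 => *; rewrite lee_fin.
pose c := Num.sqrt L0 / (2 * C * Num.sqrt L1).
have D0 : 0 < 2 * C * Num.sqrt L1 by rewrite !mulr_gt0.
have c0 : 0 < c by rewrite divr_gt0.
have cI0 : (c%:E * I = 0)%E.
  apply: (@eq0_of_finite_mass R K s0) => //; first exact: ltW.
    by rewrite mule_ge0// lee_fin ltW.
  move=> s ss0; have sp : 0 < s by exact: lt_le_trans ss0.
  have HA L : L0 <= L <= L1 -> 0 <= L / s ^+ 2 <= L1 / s ^+ 2.
    move=> /andP[h1 h2]; rewrite divr_ge0 ?sqr_ge0//; last by rewrite (le_trans (ltW hL0)).
    by rewrite ler_wpM2r// invr_ge0 sqr_ge0.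
  have := @density_box_bound R K Phi (fun L x => e s (x ^+ 2 + L / s ^+ 2)) s C b E0 E1 L0 L1
    mK K0 mPhi Phi0 sp C0 b0 hL0 L01.
  move=> hb.
  rewrite -(@lee_pmul2l _ (2 * C * Num.sqrt L1)%:E)// muleA -EFinM.
  have -> : 2 * C * Num.sqrt L1 * c = Num.sqrt L0.
    by rewrite /c mulrC divfK// gt_eqF.
  rewrite muleA -EFinM; apply: hb.
  - by move=> L hL; have [] := H s _ ss0 (HA _ hL).
  - move=> L hL; have [_ h1 h2] := H s _ ss0 (HA _ hL).
    by rewrite expr0n/= add0r.
  - move=> L x hL x0; apply: PhiK => //; rewrite addr_ge0 ?sqr_ge0//.
    by have /andP[] := HA _ hL.
move/eqP: cI0; rewrite mule_eq0 eqe gt_eqF//= => /eqP; exact.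
Qed.

Lemma nondecreasing_from (f : R -> R) (a : R) :
  (forall r, a <= r -> derivable f r 1) -> (forall r, a <= r -> 0 <= derive1 f r) ->
  forall x y, a <= x -> x <= y -> f x <= f y.
Proof.
move=> df f0 x y ax xy.
apply: (@ger0_derive1_ndecry R f a) => // [r|r|].
- by rewrite in_itv/= andbT => /ltW; exact: df.
- by rewrite in_itv/= andbT => /ltW; exact: f0.
- by apply: derivable_within_continuous => r; rewrite in_itv/= andbT; exact: df.
Qed.

Lemma nondecreasing_limit (u : R -> R) (r0 B : R) :
  (forall r, 0 < r -> derivable u r 1) -> (forall r, 0 < r -> 0 <= derive1 u r) ->
  (forall r, r0 <= r -> u r <= B) ->
  exists l, [/\ u r @[r --> +oo] --> l, (forall r, 0 < r -> u r <= l) &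
    forall x y, 0 < x -> x <= y -> u x <= u y].
Proof.
move=> du u0 uB.
have ndu x y : 0 < x -> x <= y -> u x <= u y.
  move=> x0; apply: (@nondecreasing_from u x) => // r xr.
    by apply: du; exact: lt_le_trans xr.
  by apply: u0; exact: lt_le_trans xr.
(* [u] is controlled at positive radii only; [v] is monotone on the whole line and agrees with [u]
   from 1 on. *)
pose v r := u (Num.max r 1).
have ndv : {homo v : x y / x <= y}.
  by move=> x y xy; apply: ndu; [rewrite lt_max ltr01 orbT|rewrite ge_max !le_max xy lexx orbT].
have ubv : has_ubound (range v).
  exists B => _ [r _ <-]; apply: (@le_trans _ _ (v (Num.max r r0))).
    by apply: ndv; rewrite le_max lexx.
  by apply: uB; rewrite !le_max lexx orbT.
exists (sup (range v)); split => //.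
- apply: cvg_trans (nondecreasing_cvgr ndv ubv); apply: near_eq_cvg; near=> r.
  by rewrite /v; congr u; apply/max_idPl; near: r; exact: nbhs_pinfty_ge.
- move=> r r0'; apply: (@le_trans _ _ (v r)).
    by apply: ndu => //; rewrite le_max lexx.
  by apply: ub_le_sup => //; exists r.
Unshelve. all: by end_near. Qed.

End kinetic.

(** * Bounds on the potential *)

Section potential.
Variable R : realType.

(* [U] is only controlled on ]0, +oo[; its values at negative radii are never used. *)
Definition restrict_radius (U : R -> R) (r : R) : R := if 0 < r then U r else U 0.

Lemma measurable_restrict_radius (U : R -> R) :
  (forall r, 0 < r -> derivable U r 1) ->
  measurable_fun [set: R] (restrict_radius U).
Proof.
move=> dU; apply: measurable_fun_if => //; first exact: measurable_fun_ltr.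
rewrite setTI (_ : _ @^-1` _ = `]0, +oo[%classic); last first.
  by apply/seteqP; split => x /=; rewrite in_itv/= andbT.
apply: subspace_continuous_measurable_fun => //.
by apply: derivable_within_continuous => r; rewrite in_itv/= andbT; exact: dU.
Qed.

Lemma restrict_radiusE (U : R -> R) (r : R) : 0 <= r -> restrict_radius U r = U r.
Proof. by rewrite /restrict_radius le_eqVlt => /orP[/eqP<-|->//]; rewrite ltxx. Qed.

(** The components of [p] are [|x|], [|v|^2] and [L], in the order used by [dens]. *)
Definition kernel_nr (Phi : R * R -> R) (U : R -> R) (p : vec3 R) : R :=
  Phi (c2 p / 2 + restrict_radius U (c1 p), c3 p).

Definition kernel_r (Phi : R * R -> R) (mu : R -> R) (p : vec3 R) : R :=
  Num.sqrt (1 + c2 p) *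
  Phi (expR (restrict_radius mu (c1 p)) * Num.sqrt (1 + c2 p), c3 p).

Lemma rho_nrE (Phi : R * R -> R) (U : R -> R) (x : vec3 R) :
  rho_nr Phi U x = dens (kernel_nr Phi U) x.
Proof.
by apply: eq_integral => v _; rewrite /kernel_nr /= restrict_radiusE// norm3_ge0.
Qed.

Lemma rho_rE (Phi : R * R -> R) (mu : R -> R) (x : vec3 R) :
  rho_r Phi mu x = dens (kernel_r Phi mu) x.
Proof.
by apply: eq_integral => v _; rewrite /kernel_r /f_r /= restrict_radiusE// norm3_ge0.
Qed.

Lemma measurable_kernel_nr (Phi : R * R -> R) (U : R -> R) :
  measurable_fun [set: _] Phi -> (forall r, 0 < r -> derivable U r 1) ->
  measurable_fun [set: _] (kernel_nr Phi U).
Proof.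
move=> mPhi dU; apply: (measurableT_comp mPhi); apply: measurable_fun_pair.
  apply: measurable_funD; first by apply: measurable_funM => //; exact: measurable_c2.
  exact: (measurableT_comp (measurable_restrict_radius dU) (@measurable_c1 R)).
exact: measurable_c3.
Qed.

Lemma measurable_kernel_r (Phi : R * R -> R) (mu : R -> R) :
  measurable_fun [set: _] Phi -> (forall r, 0 < r -> derivable mu r 1) ->
  measurable_fun [set: _] (kernel_r Phi mu).
Proof.
move=> mPhi dmu.
have m : measurable_fun [set: vec3 R] (fun p => Num.sqrt (1 + c2 p)).
  apply: (measurableT_comp (@measurable_sqrt R)).
  by apply: measurable_funD => //; exact: measurable_c2.
apply: measurable_funM => //.
apply: (measurableT_comp mPhi); apply: measurable_fun_pair; last exact: measurable_c3.
apply: measurable_funM => //; apply: (measurableT_comp (@measurable_expR R)).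
exact: (measurableT_comp (measurable_restrict_radius dmu) (@measurable_c1 R)).
Qed.

Lemma is_derive_inv (r : R) : r != 0 -> is_derive r (1 : R) (fun x : R => x^-1) (- r ^- 2).
Proof.
move=> r0.
have := @is_deriveV R id r 1 1 r0 (is_derive_id r 1).
by move=> h; apply: is_derive_eq h _; rewrite /GRing.scale/= mulr1.
Qed.

(** The function [- U x - k / x] has derivative [k / x^2 - U' x >= 0]; comparing its values at 1 and
    [r] gives the bound. *)
Lemma potential_bound_nr (U : R -> R) (k : R) : 0 <= k ->
  (forall r, 0 < r -> derivable U r 1) ->
  (forall r, 0 < r -> derive1 U r <= k / r ^+ 2) ->
  forall r, 1 <= r -> U r <= U 1 + k.
Proof.
move=> k0 dU U'le r r1.
pose f x := - U x - k * x^-1.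
have df (x : R) : 1 <= x -> is_derive x (1 : R) f (- derive1 U x + k * x ^- 2).
  move=> x1; have x0 : 0 < x by lra.
  have := dU _ x0; rewrite derive1E => /derivableP dUx.
  have dV := is_derive_inv (lt0r_neq0 x0).
  by apply: is_derive_eq; rewrite /GRing.scale/=; ring.
have ndf : forall x y, 1 <= x -> x <= y -> f x <= f y.
  apply: nondecreasing_from => x x1; first by have [] := df _ x1.
  rewrite derive1E (@derive_val _ _ _ _ _ _ _ (df _ x1)).
  by have := U'le x (lt_le_trans ltr01 x1); lra.
have := ndf 1 r (lexx 1) r1; rewrite /f invr1.
have : 0 <= k * r^-1 by rewrite mulr_ge0// invr_ge0; lra.
lra.
Qed.

Lemma potential_bound_r (lam mu : R -> R) (k : R) : 0 <= k ->
  (forall r, 0 < r -> derivable lam r 1) -> (forall r, 0 < r -> derivable mu r 1) ->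
  (forall r, 0 < r -> 0 <= r * (1 - expR (- 2 * lam r)) / 2 <= k) ->
  (forall r, 0 < r -> 0 <= expR (- 2 * lam r) * (2 * r * derive1 lam r - 1) + 1) ->
  (forall r, 0 < r -> 0 <= expR (- 2 * lam r) * (2 * r * derive1 mu r + 1) - 1) ->
  (forall r, 0 < r -> expR (- 2 * lam r) * (2 * r * derive1 mu r + 1) - 1 <=
     expR (- 2 * lam r) * (2 * r * derive1 lam r - 1) + 1) ->
  (forall r, 0 < r -> 0 <= derive1 mu r) /\
  exists B, forall r, 4 * k + 1 <= r -> mu r <= B.
Proof.
move=> k0 dlam dmu mk rho0 p0 prho.
pose E r := expR (- 2 * lam r).
have E0 r : 0 < E r by exact: expR_gt0.
(* The mass function recovered from [lam], with values in [[0, k]] by [mk]. In particular [E <= 1],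
   so a negative [mu'] would contradict the nonnegativity in [p0]. *)
pose m r := r * (1 - E r) / 2.
have mu'0 r : 0 < r -> 0 <= derive1 mu r.
  move=> r0; have := p0 _ r0; have /andP[] := mk _ r0; rewrite -!/(E r) => h1 h2 h3.
  have E1 : E r <= 1.
    rewrite leNgt; apply/negP => E1; have : r * (E r - 1) > 0 by rewrite mulr_gt0//; lra.
    by lra.
  rewrite leNgt; apply/negP => h.
  have : E r * (r * - derive1 mu r) > 0 by rewrite !mulr_gt0//; lra.
  lra.
split=> //.
(* From this radius on, [2 m / r <= 1 / 2], that is, [E >= 1 / 2]. *)
set r0 := 4 * k + 1; have r00 : 0 < r0 by rewrite /r0; lra.
(* Monotone beyond [r0]: in [mu' <= 2 m / x^2 + 2 m' / x] the first term is at most [2 k / x^2], the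
   second at most [(2 / r0) m'], and [f'] is the sum of these bounds minus [mu']. *)
pose f x := 2 / r0 * m x - 2 * k * x^-1 - mu x.
pose m' x := (1 - E x) / 2 + x * derive1 lam x * E x.
have df (x : R) : r0 <= x -> is_derive x (1 : R) f (2 / r0 * m' x + 2 * k * x ^- 2 - derive1 mu x).
  move=> x1; have x0 : 0 < x by lra.
  have := dlam _ x0; rewrite /m' derive1E => /derivableP dlx.
  have := dmu _ x0; rewrite derive1E => /derivableP dmx.
  have dV := is_derive_inv (lt0r_neq0 x0).
  rewrite /f /m /E.
  by apply: is_derive_eq; rewrite /GRing.scale/=; field; rewrite !gt_eqF.
have ndf : forall x y, r0 <= x -> x <= y -> f x <= f y.
  apply: nondecreasing_from => x x1; first by have [] := df _ x1.
  rewrite derive1E (@derive_val _ _ _ _ _ _ _ (df _ x1)).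
  have x0 : 0 < x by lra.
  have := prho _ x0; have := rho0 _ x0; have /andP[] := mk _ x0; rewrite -!/(E x) => h1 h2 h3 h4.
  have := mu'0 _ x0; move: (derive1 mu x) h4 => u h4 u0.
  have m'0 : 0 <= m' x by rewrite /m'; lra.
  have E12 : 1 / 2 <= E x.
    rewrite leNgt; apply/negP => E1; have : x * (1 / 2 - E x) > 0 by rewrite mulr_gt0//; lra.
    by rewrite /r0 in x1; lra.
  (* The right-hand side in [prho] is [2 m'], and [1 - E = 2 m / x]. *)
  have h5 : x * u * E x <= m x / x + m' x.
    have -> : m x / x = (1 - E x) / 2 by rewrite /m; field; rewrite gt_eqF.
    by rewrite /m'; lra.
  have h6 : x * u * (1 / 2) <= x * u * E x by rewrite ler_wpM2l// mulr_ge0// ltW.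
  have h7 : u <= 2 * m x / x ^+ 2 + 2 * m' x / x.
    rewrite -(ler_pM2l x0).
    have -> : x * (2 * m x / x ^+ 2 + 2 * m' x / x) = 2 * (m x / x + m' x) by field; rewrite gt_eqF.
    by lra.
  have h8 : 2 * m x / x ^+ 2 <= 2 * k * x ^- 2.
    by rewrite ler_wpM2r ?invr_ge0 ?sqr_ge0//; rewrite /m; lra.
  have h9 : 2 * m' x / x <= 2 / r0 * m' x.
    rewrite mulrAC ler_wpM2r// ler_wpM2l// lef_pV2//.
  lra.
exists (2 / r0 * k - f r0) => r rr.
have := ndf r0 r (lexx r0) rr; rewrite {2}/f.
have rp : 0 < r by lra.
have /andP[_ mkr] := mk _ rp.
have : 2 / r0 * m r <= 2 / r0 * k by rewrite ler_wpM2l// divr_ge0// ltW.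
have : 0 <= 2 * k * r^-1 by rewrite !mulr_ge0// invr_ge0 ltW.
lra.
Qed.

End potential.

(** * The two cases of the theorem *)

Section final.
Variable R : realType.

(** At [(r, 0, 0)] the radial velocity is [v_1], and [v_1^2 <= 1 + |v|^2] compares the
    integrands. *)
Lemma p_r_le_rho_r (Phi : R * R -> R) (mu : R -> R) (r : R) :
  (forall z, 0 <= Phi z) -> 0 < r ->
  (p_r Phi mu (radial_pt r) <= rho_r Phi mu (radial_pt r))%E.
Proof.
move=> Phi0 r0.
have sq v : 0 < Num.sqrt (1 + norm3 v ^+ 2) :> R.
  by rewrite sqrtr_gt0 ltr_pwDl ?sqr_ge0.
have f0 v : 0 <= f_r Phi mu (radial_pt r) v by exact: Phi0.
apply: ge0_le_integralW => // v _; rewrite lee_fin.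
- by apply: divr_ge0; [apply: mulr_ge0 => //; exact: sqr_ge0|exact: sqrtr_ge0].
- by apply: mulr_ge0 => //; exact: sqrtr_ge0.
rewrite ler_pdivrMr// [leRHS]mulrAC ler_wpM2r// -expr2 sqr_sqrtr; last first.
  by rewrite addr_ge0 ?sqr_ge0.
rewrite (norm3_radial (ltW r0)) sqr_norm3.
have -> : dot3 (radial_pt r) v / r = c1 v.
  by rewrite /dot3 /c1 /c2 /c3/=; field; rewrite gt_eqF.
by rewrite /dot3; have := sqr_ge0 (c2 v); have := sqr_ge0 (c3 v); lra.
Qed.

Lemma p_r_ge0 (Phi : R * R -> R) (mu : R -> R) (x : vec3 R) :
  (forall z, 0 <= Phi z) -> (0 <= p_r Phi mu x)%E.
Proof.
move=> Phi0; apply: integral_ge0 => v _; rewrite lee_fin.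
by apply: divr_ge0; [apply: mulr_ge0; [exact: sqr_ge0|exact: Phi0]|exact: sqrtr_ge0].
Qed.

Lemma vanishing_nonrelativistic (Phi : R * R -> R) (U : R -> R) :
  measurable_fun [set: _] Phi -> (forall z, 0 <= Phi z) ->
  (forall r, 0 < r -> derivable U r 1) ->
  (forall r, 0 < r ->
     ((derive1 U) r)%:E =
     ((4 * pi / r ^+ 2)%:E *
       \int[@lebesgue_measure R]_(s in `[0%R, r])
          ((s ^+ 2)%:E * rho_nr Phi U (radial_pt s)))%E) ->
  (\int[leb3 R]_x rho_nr Phi U x < +oo)%E ->
  exists Uinf : R,
    U r @[r --> +oo] --> Uinf /\
    {ae leb2 R, forall z : R * R, Uinf < z.1 -> 0 < z.2 -> Phi z = 0}.
Proof.
move=> mPhi Phi0 dU U'E Moo.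
set K := kernel_nr Phi U.
have mK : measurable_fun [set: _] K by exact: measurable_kernel_nr.
have K0 z : 0 <= K z by exact: Phi0.
have rhoE : rho_nr Phi U = dens K by apply/funext => x; exact: rho_nrE.
rewrite rhoE in U'E Moo.
have M0 : (0 <= \int[leb3 R]_x dens K x)%E by apply: integral_ge0 => *; exact: dens_ge0.
pose M := fine (\int[leb3 R]_x dens K x).
have ME : (\int[leb3 R]_x dens K x = M%:E)%E by rewrite fineK// ge0_fin_numE.
have M0' : 0 <= M by rewrite -lee_fin -ME.
(* The factor [4 pi] of the field equation times the factor 4 of [dens_mass_le]. *)
pose k := 16 * pi * M.
have k0 : 0 <= k by rewrite !mulr_ge0// pi_ge0.
have c0 (r : R) : 0 < r -> 0 <= 4 * pi / r ^+ 2.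
  by move=> r0; rewrite divr_ge0 ?sqr_ge0// mulr_ge0// pi_ge0.
have U'0 r : 0 < r -> 0 <= derive1 U r.
  move=> r0; rewrite -lee_fin U'E// mule_ge0 ?lee_fin ?c0//.
  by apply: integral_ge0 => s _; rewrite mule_ge0 ?dens_ge0// lee_fin sqr_ge0.
have U'k r : 0 < r -> derive1 U r <= k / r ^+ 2.
  move=> r0; rewrite -lee_fin U'E//.
  apply: (@le_trans _ _ ((4 * pi / r ^+ 2)%:E * (4%:E * M%:E))%E).
    by rewrite lee_wpmul2l ?lee_fin ?c0// -ME; apply: dens_mass_le => //; exact: ltW.
  by rewrite -!EFinM lee_fin /k le_eqVlt; apply/orP; left; apply/eqP; ring.
have UB := potential_bound_nr k0 dU U'k.
have [Uinf [cvU Ule ndU]] := nondecreasing_limit dU U'0 UB.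
exists Uinf; split=> //.
apply: (@vanishing_of_finite_mass R K Phi (fun s n => n / 2 + U s)) => //.
  by move=> s n L s0 n0; rewrite /K /kernel_nr /c1/= restrict_radiusE// ltW.
move=> E0 E1 L1 hE0 L10.
(* For [s >= s0] one has [s^2 >= s0 >= L1 / (E0 - Uinf)], hence [A <= E0 - Uinf] and
   [A / 2 + U s <= E0]. *)
pose s0 := 1 + L1 / (E0 - Uinf).
have dE0 : 0 < E0 - Uinf by rewrite subr_gt0.
have s01 : 1 <= s0 by rewrite /s0 lerDl divr_ge0// ltW.
(* As [b >= 1], [b^2 / 2 >= b / 2 >= E1 - U s0], so the energy [E1] is reached for all [s >= s0] by
   monotonicity of [U]. The same [b] is the Lipschitz constant of [x^2 / 2] on [[0, b]]. *)
pose b := 1 + 2 * `|E1 - U s0|.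
have b1 : 1 <= b by rewrite /b lerDl mulr_ge0.
exists s0, b, b; split; [lra|lra|lra|move=> s A ss0 /andP[A0 AL]].
have s_gt0 : 0 < s by lra.
split.
- move=> x y x0 xy yb; apply/andP; split; first by nra.
  nra.
- have AE : A <= E0 - Uinf.
    apply: (le_trans AL); rewrite ler_pdivrMr ?exprn_gt0//.
    apply: (@le_trans _ _ ((E0 - Uinf) * s0)).
      by rewrite /s0 mulrDr mulr1 mulrCA divff ?gt_eqF// mulr1 lerDr ltW.
    rewrite ler_wpM2l ?(ltW dE0)// (le_trans ss0)// expr2.
    by rewrite ler_peMl//; lra.
  have := Ule _ s_gt0; lra.
- have := ndU s0 s _ ss0; have : 0 < s0 by lra.
  move=> s00 /(_ s00) h; have := ler_norm (E1 - U s0).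
  have : b <= b ^+ 2 by rewrite expr2 ler_peMl//; lra.
  rewrite {1}/b; lra.
Qed.

Lemma vanishing_relativistic (Phi : R * R -> R) (lam mu : R -> R) :
  measurable_fun [set: _] Phi -> (forall z, 0 <= Phi z) ->
  (forall r, 0 < r -> derivable lam r 1) ->
  (forall r, 0 < r -> derivable mu r 1) ->
  (forall r, 0 < r ->
     (expR (- 2 * lam r) * (2 * r * (derive1 lam) r - 1) + 1)%:E =
     ((8 * pi * r ^+ 2)%:E * rho_r Phi mu (radial_pt r))%E) ->
  (forall r, 0 < r ->
     (expR (- 2 * lam r) * (2 * r * (derive1 mu) r + 1) - 1)%:E =
     ((8 * pi * r ^+ 2)%:E * p_r Phi mu (radial_pt r))%E) ->
  (forall r, 0 < r ->
     (expR (- 2 * lam r))%:E = (1%:E - (2 / r)%:E * mass_r Phi mu r)%E) ->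
  (\int[leb3 R]_x rho_r Phi mu x < +oo)%E ->
  exists muinf : R,
    mu r @[r --> +oo] --> muinf /\
    {ae leb2 R, forall z : R * R, expR muinf < z.1 -> 0 < z.2 -> Phi z = 0}.
Proof.
move=> mPhi Phi0 dlam dmu rhoF pF massF Moo.
set K := kernel_r Phi mu.
have mK : measurable_fun [set: _] K by exact: measurable_kernel_r.
have K0 z : 0 <= K z by rewrite mulr_ge0// sqrtr_ge0.
have rhoE : rho_r Phi mu = dens K by apply/funext => x; exact: rho_rE.
rewrite rhoE in Moo.
have M0 : (0 <= \int[leb3 R]_x dens K x)%E by apply: integral_ge0 => *; exact: dens_ge0.
pose M := fine (\int[leb3 R]_x dens K x).
have ME : (\int[leb3 R]_x dens K x = M%:E)%E by rewrite fineK// ge0_fin_numE.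
have M0' : 0 <= M by rewrite -lee_fin -ME.
pose k := 16 * pi * M.
have pi0 := pi_ge0 R.
have k0 : 0 <= k by rewrite !mulr_ge0.
have c0 (r : R) : 0 <= 8 * pi * r ^+ 2.
  by apply: mulr_ge0; [exact: mulr_ge0|exact: sqr_ge0].
have massB r : 0 < r -> (0 <= mass_r Phi mu r <= k%:E)%E.
  move=> r0; rewrite /mass_r rhoE; apply/andP; split.
    apply: mule_ge0; first by rewrite lee_fin mulr_ge0.
    by apply: integral_ge0 => s _; rewrite mule_ge0 ?dens_ge0// lee_fin sqr_ge0.
  apply: (@le_trans _ _ ((4 * pi)%:E * (4%:E * M%:E))%E).
    rewrite lee_wpmul2l ?lee_fin ?mulr_ge0// -ME.
    by apply: dens_mass_le => //; exact: ltW.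
  by rewrite -!EFinM lee_fin /k le_eqVlt; apply/orP; left; apply/eqP; ring.
(* The regular-center condition identifies this expression with [mass_r]. *)
have mk r : 0 < r -> 0 <= r * (1 - expR (- 2 * lam r)) / 2 <= k.
  move=> r0; have := massF _ r0; have /andP[] := massB _ r0.
  case: (mass_r Phi mu r) => [m| |]//.
  rewrite -EFinM -EFinB !lee_fin => m0 mk [->].
  have -> : r * (1 - (1 - 2 / r * m)) / 2 = m by field; rewrite gt_eqF.
  by rewrite m0.
have rho0 r : 0 < r -> 0 <= expR (- 2 * lam r) * (2 * r * derive1 lam r - 1) + 1.
  move=> r0; rewrite -lee_fin rhoF// mule_ge0 ?lee_fin//.
  by rewrite rhoE; exact: dens_ge0.
have p0 r : 0 < r -> 0 <= expR (- 2 * lam r) * (2 * r * derive1 mu r + 1) - 1.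
  by move=> r0; rewrite -lee_fin pF// mule_ge0 ?lee_fin// p_r_ge0.
have prho r : 0 < r -> expR (- 2 * lam r) * (2 * r * derive1 mu r + 1) - 1 <=
    expR (- 2 * lam r) * (2 * r * derive1 lam r - 1) + 1.
  move=> r0; rewrite -lee_fin rhoF// pF// lee_wpmul2l ?lee_fin//.
  exact: p_r_le_rho_r.
have [mu'0 [B muB]] := potential_bound_r k0 dlam dmu mk rho0 p0 prho.
have [muinf [cvmu mule ndmu]] := nondecreasing_limit dmu mu'0 muB.
exists muinf; split=> //.
apply: (@vanishing_of_finite_mass R K Phi (fun s n => expR (mu s) * Num.sqrt (1 + n))) => //.
  move=> s n L s0 n0; rewrite /K /kernel_r /c1 /c2 /c3/= (restrict_radiusE _ (ltW s0)).
  rewrite ler_peMl// -[leLHS]sqrtr1 ler_wsqrtr// lerDl//.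
move=> E0 E1 L1 hE0 L10.
set einf := expR muinf in hE0 *.
have einf0 : 0 < einf by exact: expR_gt0.
have dE0 : 0 < E0 - einf by rewrite subr_gt0.
(* Gives [einf * A <= E0 - einf] for [s >= s0], hence [expR (mu s) * sqrt (1 + A) <= einf * (1 + A)
   <= E0]. *)
pose s0 := 1 + einf * L1 / (E0 - einf).
have s01 : 1 <= s0 by rewrite /s0 lerDl divr_ge0 ?mulr_ge0 ?ltW.
have s00 : 0 < s0 by lra.
(* Then [expR (mu s) * sqrt (1 + b^2 + A) >= expR (mu s0) * b = |E1|]. The Lipschitz constant is
   [einf], an upper bound of every [expR (mu s)]. *)
pose b := `|E1| / expR (mu s0).
have b0 : 0 <= b by rewrite divr_ge0// expR_ge0.
exists s0, einf, b; split=> // s A ss0 /andP[A0 AL].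
have s_gt0 : 0 < s by lra.
have es : expR (mu s) <= einf by rewrite ler_expR mule.
have e0 : 0 < expR (mu s) by exact: expR_gt0.
split.
- move=> x y x0 xy yb; have A10 : 0 <= 1 + A by lra.
  have /andP[] := sqrt_sqrD_lipschitz A10 x0 xy.
  rewrite !(addrCA 1) => h1 h2; apply/andP; split; first by rewrite ler_pM2l.
  apply: (@le_trans _ _ (expR (mu s) * Num.sqrt (x ^+ 2 + (1 + A)) + expR (mu s) * (y - x))).
    by rewrite -mulrDr ler_pM2l//; lra.
  by rewrite lerD2l ler_wpM2r// subr_ge0.
- have sA : Num.sqrt (1 + A) <= 1 + A.
    rewrite -[leRHS]ger0_norm -?sqrtr_sqr ?ler_wsqrtr//; last lra.
    by rewrite expr2 ler_peMl//; lra.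
  have AE : einf * A <= E0 - einf.
    apply: (@le_trans _ _ (einf * (L1 / s ^+ 2))); first by rewrite ler_pM2l.
    rewrite mulrA ler_pdivrMr ?exprn_gt0//.
    apply: (@le_trans _ _ ((E0 - einf) * s0)).
      by rewrite /s0 mulrDr mulr1 mulrCA divff ?gt_eqF// mulr1 lerDr ltW.
    rewrite ler_wpM2l ?(ltW dE0)// (le_trans ss0)// expr2.
    by rewrite ler_peMl//; lra.
  apply: (@le_trans _ _ (einf * (1 + A))); last by lra.
  exact: ler_pM.
- apply: (le_trans (ler_norm E1)).
  have -> : `|E1| = expR (mu s0) * b by rewrite /b mulrC divfK// gt_eqF// expR_gt0.
  apply: ler_pM => //.
    by rewrite ler_expR ndmu.
  rewrite -[leLHS]ger0_norm// -sqrtr_sqr ler_wsqrtr//; lra.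
Qed.

End final.

Unset Implicit Arguments.

Theorem theorem2p1 (R : realType) (Phi : R * R -> R)
  (mPhi : measurable_fun setT Phi) (Phi_ge0 : forall z, 0 <= Phi z) :
  (* (a) non-relativistic case *)
  (forall U : R -> R,
     {in `]0, +oo[, forall r, derivable U r 1} ->
     {within `]0, +oo[, continuous (derive1 U)} ->
     (forall r, 0 < r ->
        ((derive1 U) r)%:E =
        ((4 * pi / r ^+ 2)%:E *
          \int[@lebesgue_measure R]_(s in `[0%R, r])
             ((s ^+ 2)%:E * rho_nr Phi U (radial_pt s)))%E) ->
     (\int[leb3 R]_x rho_nr Phi U x < +oo)%E ->
     exists Uinf : R,
       U r @[r --> +oo] --> Uinf /\
       {ae leb2 R, forall z : R * R, Uinf < z.1 -> 0 < z.2 -> Phi z = 0})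
  /\
  (* (b) relativistic case *)
  (forall lam mu : R -> R,
     {in `]0, +oo[, forall r, derivable lam r 1} ->
     {within `]0, +oo[, continuous (derive1 lam)} ->
     {in `]0, +oo[, forall r, derivable mu r 1} ->
     {within `]0, +oo[, continuous (derive1 mu)} ->
     (forall r, 0 < r ->
        (expR (- 2 * lam r) * (2 * r * (derive1 lam) r - 1) + 1)%:E =
        ((8 * pi * r ^+ 2)%:E * rho_r Phi mu (radial_pt r))%E) ->
     (forall r, 0 < r ->
        (expR (- 2 * lam r) * (2 * r * (derive1 mu) r + 1) - 1)%:E =
        ((8 * pi * r ^+ 2)%:E * p_r Phi mu (radial_pt r))%E) ->
     (forall r, 0 < r ->
        (expR (- 2 * lam r))%:E = (1%:E - (2 / r)%:E * mass_r Phi mu r)%E) ->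
     (\int[leb3 R]_x rho_r Phi mu x < +oo)%E ->
     exists muinf : R,
       mu r @[r --> +oo] --> muinf /\
       {ae leb2 R, forall z : R * R, expR muinf < z.1 -> 0 < z.2 -> Phi z = 0}).
Proof.
split=> [U dU _ U'E Moo|lam mu dlam _ dmu _ rhoF pF massF Moo].
  by apply: vanishing_nonrelativistic => // r r0; apply: dU; rewrite in_itv/= r0.
by apply: (vanishing_relativistic mPhi Phi_ge0 (lam := lam)) => // r r0;
  [apply: dlam|apply: dmu]; rewrite in_itv/= r0.
Qed.
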